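(* Let $\alpha>1$, $k>0$, $p,q\in(1,\infty)$, $w(t)=t^k$, and let $U:\mathbb R^n\to\mathbb R$ be such that $h(x,t)=\hat p_t*U(x)$ belongs to $L^q_w((0,T_0),L^p(\mathbb R^n))$ for some $T_0>0$, where $\hat p_t(x)=(4\pi t)^{-n/2}e^{-|x|^2/(4t)}$. Suppose that $$\frac{k\alpha}{q-\alpha}<1,\qquad \beta:=\frac n2\Big(\frac{\alpha-1}{p}\Big)\Big(\frac{q}{q-\alpha}\Big)<1,\qquad \min\{p,q\}>\alpha,$$ $$k+(q-\alpha)\Big(1-\beta-\frac{k\alpha}{q-\alpha}\Big)>-1.$$ Then there exists $T>0$ such that the map $$\mathcal T(u)(x,t)=\hat p_t*U(x)+\int_0^t\int_{\mathbb R^n}\hat p_{t-s}(x-y)\,|u(y,s)|^{\alpha-1}u(y,s)\,dy\,ds$$ has a fixed point in $X=L^q_w((0,T),L^p(\mathbb R^n))$. Furthermore, given $A>0$, there exists $T>0$ such that any two solutions (fixed points of $\mathcal T$) in $M_A=\{u\in X:\|u\|_X\le A\}$ agree in $[0,T]$.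
   Context: For $T>0$, $X=L^q_w((0,T),L^p(\mathbb R^n))$ is the space of measurable $u$ on $\mathbb R^n\times(0,T)$ with $\|u\|_X=\left(\int_0^T\|u(\cdot,t)\|_{L^p(\mathbb R^n)}^q\,t^k\,dt\right)^{1/q}<\infty$. A fixed point of $\mathcal T$ is by definition a (mild) solution of $\partial_tu-\Delta u=|u|^{\alpha-1}u$, $u(\cdot,0)=U$. Here $X$, $M_A$ and $\mathcal T$ are considered on the time interval $(0,T)$. *)

(* Defs.v *)
From HB Require Import structures.
From mathcomp Require Import all_boot all_order all_algebra.
From mathcomp Require Import all_classical all_reals all_analysis.
From mathcomp Require Import measurable_realfun.

Set Implicit Arguments.
Unset Strict Implicit.
Unset Printing Implicit Defensive.

Import Order.TTheory GRing.Theory Num.Theory.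
Import numFieldNormedType.Exports.

Local Open Scope classical_set_scope.
Local Open Scope ring_scope.

(* R^n, with the product (Borel) sigma-algebra. *)
Notation Rn R n := (n.-tuple (measurableTypeR R)).

Section lebesgue_Rn.
Context {R : realType}.

Definition consRn n (z : measurableTypeR R * Rn R n) : Rn R n.+1 :=
  [tuple of z.1 :: z.2].

Fixpoint lebesgueRn (n : nat) : set (Rn R n) -> \bar R :=
  match n with
  | 0 => dirac ([tuple] : Rn R 0)
  | m.+1 => pushforward (@lebesgue_measure R \x @lebesgueRn m)%E (@consRn m)
  end.

Lemma measurable_consRn n : measurable_fun [set: measurableTypeR R * Rn R n]
  (@consRn n).
Proof. exact: measurable_cons. Qed.

Let lebesgueRn_exists n :
  exists mu : {sigma_finite_measure set (Rn R n) -> \bar R},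
    @lebesgueRn n = mu :> (set _ -> _).
Proof.
elim: n => [|n [mu IH]] /=.
  pose mu : {measure set (Rn R 0) -> \bar R} := dirac ([tuple] : Rn R 0).
  have mu_fin : sigma_finite setT mu.
    by apply: fin_num_fun_sigma_finite; [rewrite measure0|exact: fin_num_measure].
  pose HS := Measure_isSigmaFinite.Build _ _ _ mu mu_fin.
  pose mu' : {sigma_finite_measure set (Rn R 0) -> \bar R} := HB.pack (mu : set _ -> _) mu HS.
  by exists mu'.
rewrite IH.
pose leb : {sigma_finite_measure set (measurableTypeR R) -> \bar R} :=
  lebesgue_measure.
pose nu : {measure set (measurableTypeR R * Rn R n)%type -> \bar R} :=
  (leb \x mu)%E.
pose M : {measure set (Rn R n.+1) -> \bar R} :=
  measure_function_pushforward__canonical__measure_function_Measure nu (@measurable_consRn n).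
have M_fin : sigma_finite setT M.
  have [[F UF mF]] :=
    lebesgue_integral_fubini.measure_function_Measure_isSigmaFinite__to__measure_function_isSigmaFinite
      leb mu.
  pose uncons (x : Rn R n.+1) : (measurableTypeR R * Rn R n)%type :=
    (thead x, [tuple of behead x]).
  have unconsK : cancel (@consRn n) uncons.
    by move=> [x y]; rewrite /uncons/= theadE; congr pair; exact: val_inj.
  have muncons : measurable_fun setT uncons.
    apply/measurable_fun_pairP; split.
      exact: (@measurable_tnth _ (measurableTypeR R) n.+1 ord0).
    exact: measurable_behead.
  exists (fun k => uncons @^-1` F k).
    by rewrite -preimage_bigcup -UF preimage_setT.
  move=> k; have [mFk Fkoo] := mF k; split.
    by rewrite -[X in measurable X]setTI; exact: muncons.
  rewrite /M/= /pushforward -comp_preimage.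
  by rewrite (_ : uncons \o _ = id) ?preimage_id//; apply/funext => z; exact: unconsK.
pose HS := Measure_isSigmaFinite.Build _ _ _ M M_fin.
pose M' : {sigma_finite_measure set (Rn R n.+1) -> \bar R} := HB.pack (M : set _ -> _) M HS.
by exists M'.
Qed.

Let lebesgueRn0 n : @lebesgueRn n set0 = 0%E.
Proof. by have [mu ->] := lebesgueRn_exists n; exact: measure0. Qed.

Let lebesgueRn_ge0 n A : (0 <= @lebesgueRn n A)%E.
Proof. by have [mu ->] := lebesgueRn_exists n; exact: measure_ge0. Qed.

Let lebesgueRn_sigma_additive n : semi_sigma_additive (@lebesgueRn n).
Proof.
by have [mu ->] := lebesgueRn_exists n; exact: measure_semi_sigma_additive.
Qed.

HB.instance Definition _ n := isMeasure.Build _ _ _ (@lebesgueRn n)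
  (lebesgueRn0 n) (@lebesgueRn_ge0 n) (@lebesgueRn_sigma_additive n).

Let lebesgueRn_sigma_finite n : sigma_finite setT (@lebesgueRn n).
Proof. by have [mu ->] := lebesgueRn_exists n; exact: sigma_finiteT. Qed.

HB.instance Definition _ n := Measure_isSigmaFinite.Build _ _ _ (@lebesgueRn n)
  (@lebesgueRn_sigma_finite n).

End lebesgue_Rn.

Section heat_equation.
Context {R : realType} {n : nat}.
Local Notation leb := (@lebesgue_measure R).
Local Notation lebn := (@lebesgueRn R n).
Local Notation spacetime := (Rn R n * measurableTypeR R)%type.
Implicit Types (p q k T alpha t : R) (x y : Rn R n) (z : spacetime).

Definition subRn x y : Rn R n :=
  [tuple (tnth x i : R) - (tnth y i : R) | i < n].

Definition heat_kernel t x : R :=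
  (4 * pi * t) `^ (- (n%:R / 2)) *
  expR (- (\sum_(i < n) (tnth x i : R) ^+ 2) / (4 * t)).

(* [heat_flow] and [mild_map] take values in \bar R. An integral that is not
   absolutely convergent is infinite in the library (+oo - oo = -oo), so that
   having a finite [mixed_norm], or being a.e. equal to a real-valued function,
   forces the convergence of these integrals almost everywhere. *)
Definition heat_flow (U : Rn R n -> R) z : \bar R :=
  (\int[lebn]_y (heat_kernel z.2 (subRn z.1 y) * U y)%:E)%E.

Definition mild_map alpha (U : Rn R n -> R) (u : spacetime -> R) z : \bar R :=
  (heat_flow U z +
   \int[leb]_(s in `]0%R, z.2[) \int[lebn]_y
     (heat_kernel (z.2 - s) (subRn z.1 y) *
      (`|u (y, s)| `^ (alpha - 1) * u (y, s)))%:E)%E.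

Definition mixed_norm p q k T (u : spacetime -> \bar R) : \bar R :=
  ((\int[leb]_(t in `]0%R, T[)
     ('N[lebn]_p%:E[(fun x => u (x, t))] `^ q * (t `^ k)%:E)) `^ q^-1)%E.

Definition slab T : set spacetime := [set z | 0 < (z.2 : R) < T].

(* Elements are genuine functions on spacetime, of which only the restriction
   to [slab T] matters; they are identified by [ae_eq_on]. *)
Definition mixed_space p q k T : set (spacetime -> \bar R) :=
  [set u | measurable_fun (slab T) u /\ (mixed_norm p q k T u < +oo)%E].

Definition ae_eq_on T (u v : spacetime -> \bar R) : Prop :=
  u = v %[ae (lebn \x leb)%E in slab T].

Definition mild_solution alpha p q k T (U : Rn R n -> R) (u : spacetime -> R) :
    Prop :=
  mixed_space p q k T (EFin \o u) /\
  ae_eq_on T (EFin \o u) (mild_map alpha U u).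

End heat_equation.

(* Main.v *)
Require Import Defs.
From HB Require Import structures.
From mathcomp Require Import all_boot all_order all_algebra.
From mathcomp Require Import all_classical all_reals all_analysis.
From mathcomp Require Import measurable_realfun ring lra.
Import Order.TTheory GRing.Theory Num.Theory.
Import numFieldNormedType.Exports.
Set Implicit Arguments.
Unset Strict Implicit.
Unset Printing Implicit Defensive.

Local Open Scope classical_set_scope.
Local Open Scope ring_scope.

(** Write E_T(f) for the [energy] of f, which for f >= 0 is the q-th power of the norm of X, and
    N(g) for the [duhamel] integral of g. Everything rests on one estimate, [energy_duhamel_le]: for
    f >= 0, E_T(N(f^alpha)) <= C T^r E_T(f)^alpha, where gamma = k alpha/(q - alpha), r = k + (q -
    alpha)(1 - beta - gamma) + 1 > 0, and C does not depend on T or f.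

    The estimate combines the smoothing of the heat flow from L^(p/alpha) to L^p at the rate (t -
    s)^(-(n/2)(alpha - 1)/p) ([heat_avg_smoothing]), Minkowski's inequality for the time integral
    ([duhamel_slice_le]) and Hoelder's inequality in time. The latter leaves the integral of (t -
    s)^(-beta) s^(-gamma) over 0 < s < t, which is at most a constant times t^(1 - beta - gamma)
    because beta and gamma are below 1; the last hypothesis makes the resulting power of t, times
    t^k, integrable at 0.

    Existence goes by order rather than by contraction. With h the heat flow of U and T small, the
    iterates of V -> |h| + N(V^alpha) from 0 increase and keep bounded energy, so their limit is a
    supersolution V of finite energy ([supersolution_exists]). The nonlinearity is nondecreasing, so
    u -> h + N(|u|^(alpha-1) u) preserves order and the bounds -V <= u <= V; iterating it from -V,
    monotone convergence gives a fixed point ([mild_fixed_point]). [mild_solution_exists] deals with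
    the null set where V is infinite.

    For uniqueness ([mild_solution_unique]), w = |u - v| satisfies w <= m N((|u| + |v|)^(alpha-1) w)
    almost everywhere. For every delta > 0 the source here is at most delta (|u| + |v| +
    w/delta)^alpha, so the estimate for a single function applies. Choosing delta so that w/delta
    has the energy allowed for |u| + |v| gives E_T(w) <= X T^r E_T(w), with X depending on A but not
    on u, v or T; for X T^r < 1 this forces E_T(w) = 0. *)

Section ereal_power.
Context {R : realType}.
Local Open Scope ereal_scope.
Implicit Types x y : \bar R.

(** * Powers of nonnegative extended reals *)

Lemma le_poweR (r : R) x y : (0 <= r)%R -> 0 <= x -> x <= y -> x `^ r <= y `^ r.
Proof.
move=> r0 x0 xy; apply: gt0_ler_poweR => //; rewrite in_itv/= leey andbT //.
exact: le_trans xy.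
Qed.

Lemma poweRD_gt0 x (r s : R) : (0 < r)%R -> (0 < s)%R ->
  x `^ (r + s) = x `^ r * x `^ s.
Proof. by move=> r0 s0; rewrite poweRD// add_neq0_poweRD_def// gt_eqF// addr_gt0. Qed.

(** A weighted geometric mean is at most the maximum, hence at most the sum. *)
Lemma poweR_interp_le x y (th : R) : (0 < th < 1)%R -> 0 <= x -> 0 <= y ->
  x `^ (1 - th) * y `^ th <= x + y.
Proof.
move=> /andP[th0 th1] x0 y0.
have th1' : (0 < 1 - th)%R by rewrite subr_gt0.
have mE (m : \bar R) : 0 <= m -> m `^ (1 - th) * m `^ th = m.
  by move=> m0; rewrite -poweRD_gt0// subrK poweRe1.
have [xy|yx] := leP x y.
  apply: (@le_trans _ _ y); last by rewrite leeDr.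
  by rewrite -[leRHS]mE// lee_wpmul2r ?poweR_ge0// le_poweR// ltW.
apply: (@le_trans _ _ x); last by rewrite leeDl.
by rewrite -[leRHS]mE// lee_wpmul2l ?poweR_ge0// le_poweR// ltW.
Qed.

(** Bounding x + y by twice the maximum treats r < 1 and r >= 1 alike; both occur, since the power
    q/p may lie on either side of 1. *)
Lemma poweR_add_le x y (r : R) : (0 < r)%R -> 0 <= x -> 0 <= y ->
  (x + y) `^ r <= (2 `^ r)%:E * (x `^ r + y `^ r).
Proof.
move=> r0 x0 y0; have r0' := ltW r0.
have key (a b : \bar R) : 0 <= a -> a <= b ->
    (a + b) `^ r <= (2 `^ r)%:E * b `^ r.
  move=> a0 ab; have b0 := le_trans a0 ab.
  rewrite -poweR_EFin -poweRM// ?lee_fin//; apply: le_poweR => //.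
    exact: adde_ge0.
  by rewrite (_ : 2%:E = 1 + 1) // ge0_muleDl// !mul1e leeD.
have [xy|/ltW yx] := leP x y.
  apply: (le_trans (key _ _ x0 xy)); rewrite lee_wpmul2l ?lee_fin ?powR_ge0//.
  by rewrite leeDr// poweR_ge0.
rewrite addeC; apply: (le_trans (key _ _ y0 yx)).
by rewrite lee_wpmul2l ?lee_fin ?powR_ge0// leeDl// poweR_ge0.
Qed.

End ereal_power.

(** * Hoelder's inequality for nonnegative functions *)

Section integral_lemmas.
Context d (T : measurableType d) (R : realType).
Variable mu : {measure set T -> \bar R}.
Local Open Scope ereal_scope.

Lemma ge0_integral_eq0_ae (D : set T) (f : T -> \bar R) : measurable D ->
  measurable_fun D f -> (forall x, 0 <= f x) -> \int[mu]_(x in D) f x = 0 ->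
  {ae mu, forall x, D x -> f x = 0}.
Proof.
move=> mD mf f0 If; apply/(ae_eq_integral_abs mu mD mf).
by rewrite -[RHS]If; apply: eq_integral => x _; rewrite gee0_abs.
Qed.

(* The factor 2, harmless here, spares the optimal form of Young's
   inequality. *)
Lemma hoelder_interp (D : set T) (f g : T -> \bar R) (th : R) :
  (0 < th < 1)%R -> measurable D ->
  measurable_fun D f -> measurable_fun D g ->
  (forall x, 0 <= f x) -> (forall x, 0 <= g x) ->
  \int[mu]_(x in D) (f x `^ (1 - th) * g x `^ th) <=
  2%:E * ((\int[mu]_(x in D) f x) `^ (1 - th) * (\int[mu]_(x in D) g x) `^ th).
Proof.
move=> th01 mD mf mg f0 g0; have /andP[th0 th1] := th01.
have th1' : (0 < 1 - th)%R by rewrite subr_gt0.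
have mpow (h : T -> \bar R) r : measurable_fun D h ->
    measurable_fun D (fun x => h x `^ r).
  by move=> mh; apply: (measurableT_comp (@measurable_poweR _ r)).
set A := \int[mu]_(x in D) f x; set B := \int[mu]_(x in D) g x.
have A0 : 0 <= A by exact: integral_ge0.
have B0 : 0 <= B by exact: integral_ge0.
have mI : measurable_fun D (fun x => f x `^ (1 - th) * g x `^ th).
  by apply: emeasurable_funM; exact: mpow.
have vanish : {ae mu, forall x, D x -> f x `^ (1 - th) * g x `^ th = 0} ->
    \int[mu]_(x in D) (f x `^ (1 - th) * g x `^ th) = 0.
  move=> h; rewrite (@ge0_ae_eq_integral _ _ _ _ D _ (cst 0))//.
  - by rewrite integral0.
  - by move=> x _; rewrite mule_ge0// poweR_ge0.
have [A_0|A_neq0] := eqVneq A 0.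
  rewrite vanish ?mule_ge0 ?lee_fin ?poweR_ge0//.
  apply: filterS (ge0_integral_eq0_ae mD mf f0 A_0) => x h /h ->.
  by rewrite poweR0r ?mul0e// gt_eqF.
have [B_0|B_neq0] := eqVneq B 0.
  rewrite vanish ?mule_ge0 ?lee_fin ?poweR_ge0//.
  apply: filterS (ge0_integral_eq0_ae mD mg g0 B_0) => x h /h ->.
  by rewrite poweR0r ?mule0// gt_eqF.
have A_gt0 : 0 < A by rewrite lt0e A_neq0.
have B_gt0 : 0 < B by rewrite lt0e B_neq0.
have [->|A_neqy] := eqVneq A +oo.
  rewrite poweRyr ?gt_eqF// gt0_mulye ?poweR_gt0//.
  by rewrite gt0_muley ?lte_fin// leey.
have [->|B_neqy] := eqVneq B +oo.
  rewrite poweRyr ?gt_eqF// gt0_muley ?poweR_gt0//.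
  by rewrite gt0_muley ?lte_fin// leey.
have [a aE a0] : exists2 a, A = a%:E & (0 < a)%R.
  exists (fine A); first by rewrite fineK// ge0_fin_numE// ltey.
  by rewrite fine_gt0// A_gt0 ltey.
have [b bE b0] : exists2 b, B = b%:E & (0 < b)%R.
  exists (fine B); first by rewrite fineK// ge0_fin_numE// ltey.
  by rewrite fine_gt0// B_gt0 ltey.
have scaleK (c : R) (x : \bar R) : (0 < c)%R -> x = c%:E * (c^-1%:E * x).
  by move=> c0; rewrite muleA -EFinM divff ?gt_eqF// mul1e.
have vge0 (c : R) (x : \bar R) : (0 < c)%R -> 0 <= x -> 0 <= c^-1%:E * x.
  by move=> c0 x0; rewrite mule_ge0// lee_fin invr_ge0 ltW.
have a0' := ltW a0; have b0' := ltW b0.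
pose C := a%:E `^ (1 - th) * b%:E `^ th.
have C0 : 0 <= C by rewrite mule_ge0// poweR_ge0.
have mZ (c : R) h : measurable_fun D h -> measurable_fun D (fun x => c%:E * h x).
  by move=> mh; apply: emeasurable_funM => //; exact: measurable_cst.
(* The pointwise bound is applied to f/a and g/b, whose integrals are 1, so the sum integrates to
   the announced factor 2. *)
apply: (@le_trans _ _ (\int[mu]_(x in D) (C * (a^-1%:E * f x + b^-1%:E * g x)))).
  apply: ge0_le_integral => //.
  - by move=> x _; rewrite mule_ge0// poweR_ge0.
  - apply: emeasurable_funM; first exact: measurable_cst.
    by apply: emeasurable_funD; exact: mZ.
  - move=> x _; rewrite {1}(scaleK a (f x) a0) {1}(scaleK b (g x) b0).
    rewrite (@poweRM _ a%:E) ?vge0 ?lee_fin// (@poweRM _ b%:E) ?vge0 ?lee_fin//.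
    by rewrite muleACA lee_wpmul2l// poweR_interp_le// vge0.
rewrite ge0_integralZl//; last 2 first.
- by apply: emeasurable_funD; exact: mZ.
- by move=> x _; rewrite adde_ge0// vge0.
rewrite ge0_integralD//; last 4 first.
- by move=> x _; rewrite vge0.
- exact: mZ.
- by move=> x _; rewrite vge0.
- exact: mZ.
rewrite !ge0_integralZl ?lee_fin ?invr_ge0//.
rewrite -/A -/B aE bE -!EFinM !mulVf ?gt_eqF//.
by rewrite mulrC.
Qed.

End integral_lemmas.

(** * The heat kernel and its total mass *)

Section heat_kernel_theory.
Context {R : realType} {n : nat}.
Local Notation leb := (@lebesgue_measure R).
Local Notation lebn := (@lebesgueRn R n).
Local Notation spacetime := (Rn R n * measurableTypeR R)%type.
Implicit Types (p q k T alpha t s : R) (x y : Rn R n) (z : spacetime).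

Lemma heat_kernel_ge0 t x : 0 <= heat_kernel t x.
Proof. by rewrite mulr_ge0 ?powR_ge0 ?expR_ge0. Qed.

Lemma heat_kernel_le t x : 0 < t ->
  heat_kernel t x <= (4 * pi * t) `^ (- (n%:R / 2)).
Proof.
move=> t0; rewrite ler_piMr ?powR_ge0// -expR0 ler_expR mulNr oppr_le0.
by rewrite divr_ge0 ?sumr_ge0 ?mulr_ge0 ?(ltW t0)// => i _; exact: sqr_ge0.
Qed.

Lemma heat_kernel_subC t x y :
  heat_kernel t (subRn x y) = heat_kernel t (subRn y x).
Proof.
rewrite /heat_kernel; under eq_bigr => i _ do
  rewrite tnth_mktuple -sqrrN opprB -[(_ - _)%R](tnth_mktuple
    (fun i => (tnth y i : R) - (tnth x i : R))).
by [].
Qed.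

(** The kernel is a Gaussian of variance 2t in each coordinate. This factorization reduces its total
    mass to that of the one-dimensional normal density. *)
Lemma heat_kernel_prod t x y : 0 < t ->
  heat_kernel t (subRn x y) =
  \prod_(i < n) normal_pdf (tnth x i : R) (Num.sqrt (2 * t)) (tnth y i).
Proof.
move=> t0; have t20 : 0 < 2 * t by rewrite mulr_gt0.
have s0 : Num.sqrt (2 * t) != 0 by rewrite gt_eqF// sqrtr_gt0.
under eq_bigr do rewrite normal_pdfE//.
rewrite big_split/= /normal_peak /normal_fun sqr_sqrtr; last exact: ltW.
rewrite -expR_sum big_const_ord iter_mulr_1; congr (_ * expR _).
  rewrite (_ : 2 * t * pi *+ 2 = 4 * pi * t); last by rewrite -mulr_natr; ring.
  have p0 : 0 < 4 * pi * t by rewrite !mulr_gt0// pi_gt0.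
  rewrite -powR12_sqrt ?ltW// -powRN -powR_mulrn ?powR_ge0// -powRrM.
  by congr (_ `^ _); ring.
rewrite -sumrN mulr_suml; apply: eq_bigr => i _.
rewrite tnth_mktuple -sqrrN opprB; congr (_ / _).
by rewrite -mulr_natr; ring.
Qed.

End heat_kernel_theory.

(** As [lebesgueRn] adjoins one coordinate at a time, Tonelli splits off one factor, of integral 1,
    at each step of an induction on the dimension. *)
Lemma integral_prod_lebesgueRn (R : realType) (f : R -> R -> R) (n : nat)
    (x : Rn R n) :
  (forall a, measurable_fun setT (f a)) -> (forall a b, 0 <= f a b) ->
  (forall a, \int[@lebesgue_measure R]_b (f a b)%:E = 1)%E ->
  (\int[@lebesgueRn R n]_y (\prod_(i < n) f (tnth x i) (tnth y i))%:E = 1)%E.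
Proof.
move=> mf f0 f1; elim: n x => [x|n IH x].
  under eq_integral do rewrite big_ord0.
  rewrite integral_cst//= mul1e.
  by rewrite diracE mem_set.
have mprod m (x' : Rn R m) : measurable_fun [set: Rn R m]
    (fun y : Rn R m => (\prod_(i < m) f (tnth x' i) (tnth y i))%:E).
  apply/measurable_EFinP; apply: measurable_prod => i _.
  exact: (measurableT_comp (mf _) (measurable_tnth i)).
have prod0 m (x' y : Rn R m) : (0 <= (\prod_(i < m) f (tnth x' i) (tnth y i))%:E)%E.
  by rewrite lee_fin prodr_ge0.
rewrite [LHS](ge0_integral_pushforward (@measurable_consRn R n)
  (@lebesgue_measure R \x @lebesgueRn R n)%E); last 3 first.
- exact: measurableT.
- exact: mprod.
- by move=> y _; exact: prod0.
rewrite preimage_setT fubini_tonelli1//; last 2 first.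
- exact: measurableT_comp (mprod _ _) (@measurable_consRn R n).
- by move=> y /=; exact: prod0.
rewrite -[RHS](f1 (thead x)); apply: eq_integral => a _.
rewrite /fubini_F/=.
have E (b : Rn R n) :
    (\prod_(i < n.+1) f (tnth x i) (tnth (consRn (a, b)) i))%:E =
    ((f (thead x) a)%:E *
     (\prod_(i < n) f (tnth [tuple of behead x] i) (tnth b i))%:E)%E.
  rewrite big_ord_recl EFinM; congr ((f _ _)%:E * _%:E)%E.
  apply: eq_bigr => i _; congr (f _ _); last by rewrite tnthS.
  by rewrite [in LHS](tuple_eta x) tnthS.
under eq_integral do rewrite E.
rewrite ge0_integralZl//; last by rewrite lee_fin.
  by rewrite (IH [tuple of behead x]) mule1.
exact: mprod.
Qed.
(** The inverse is x times the power -1 of x^2, a real power of a nonnegative base; at 0 both sides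
    are 0. *)
Lemma measurable_funV d (T : measurableType d) (R : realType) (f : T -> R) :
  measurable_fun setT f -> measurable_fun setT (fun x => (f x)^-1).
Proof.
move=> mf.
have -> : (fun x => (f x)^-1) = (fun x => f x * (f x ^+ 2) `^ (-1)).
  apply/funext => x; rewrite powR_inv1 ?sqr_ge0//.
  have [->|fx0] := eqVneq (f x) 0; first by rewrite mul0r invr0.
  by rewrite expr2 invfM mulrA divff// mul1r.
apply: measurable_funM => //.
exact: measurableT_comp (@measurable_powR _ _) (measurable_funX _ mf).
Qed.

(** * Heat averages, the Duhamel operator and their measurability *)

Section duhamel.
Context {R : realType} {n : nat}.
Local Notation leb := (@lebesgue_measure R).
Local Notation lebn := (@lebesgueRn R n).
Local Notation spacetime := (Rn R n * measurableTypeR R)%type.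
Implicit Types (p q k T alpha t s : R) (x y : Rn R n) (z : spacetime).
Implicit Types f g : spacetime -> \bar R.

Lemma integral_heat_kernelr t x : 0 < t ->
  (\int[lebn]_y (heat_kernel t (subRn x y))%:E = 1)%E.
Proof.
move=> t0; under eq_integral do rewrite heat_kernel_prod//.
apply: (@integral_prod_lebesgueRn R (fun a b => normal_pdf a (Num.sqrt (2 * t)) b)).
- by move=> a; exact: measurable_normal_pdf.
- by move=> a b; exact: normal_pdf_ge0.
- by move=> a; exact: integral_normal_pdf.
Qed.

Lemma integral_heat_kernell t y : 0 < t ->
  (\int[lebn]_x (heat_kernel t (subRn x y))%:E = 1)%E.
Proof.
move=> t0; under eq_integral do rewrite heat_kernel_subC.
exact: integral_heat_kernelr.
Qed.

Lemma measurable_heat_kernel d (A : measurableType d) (t : A -> R)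
    (X Y : A -> Rn R n) :
  measurable_fun setT t -> measurable_fun setT X -> measurable_fun setT Y ->
  measurable_fun setT (fun w => (heat_kernel (t w) (subRn (X w) (Y w)))%:E).
Proof.
move=> mt mX mY; apply/measurable_EFinP; rewrite /heat_kernel.
apply: measurable_funM.
  apply: measurableT_comp (@measurable_powR _ _) _.
  by apply: measurable_funM => //; exact: measurable_cst.
apply: measurableT_comp => //.
apply: measurable_funM; last first.
  by apply: measurable_funV; apply: measurable_funM => //; exact: measurable_cst.
apply: measurable_funN; apply: measurable_sum => i.
have -> : (fun w => (tnth (subRn (X w) (Y w)) i : R) ^+ 2) =
    (fun w => ((tnth (X w) i : R) - (tnth (Y w) i : R)) ^+ 2).
  by apply/funext => w; rewrite tnth_mktuple.
apply: measurable_funX; apply: measurable_funB.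
  exact: measurableT_comp (measurable_tnth i) mX.
exact: measurableT_comp (measurable_tnth i) mY.
Qed.

(** For z = (x, t) this is the convolution of the kernel at time t - s with the slice g(., s).
    Extended real values allow any nonnegative measurable g, with no integrability assumed. *)
Definition heat_avg g z s : \bar R :=
  (\int[lebn]_y ((heat_kernel ((z.2 : R) - s) (subRn z.1 y))%:E * g (y, s)))%E.

Definition duhamel g z : \bar R :=
  (\int[leb]_(s in `]0%R, (z.2 : R)[) heat_avg g z s)%E.

Section measurability.
Variable g : spacetime -> \bar R.
Hypotheses (mg : measurable_fun setT g) (g0 : forall z, (0 <= g z)%E).

Lemma heat_avg_ge0 z s : (0 <= heat_avg g z s)%E.
Proof. by apply: integral_ge0 => y _; rewrite mule_ge0// lee_fin heat_kernel_ge0. Qed.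

Lemma duhamel_ge0 z : (0 <= duhamel g z)%E.
Proof. by apply: integral_ge0 => s _; exact: heat_avg_ge0. Qed.

Lemma measurable_heat_avg : measurable_fun setT
  (fun w : spacetime * measurableTypeR R => heat_avg g w.1 w.2).
Proof.
apply: (@measurable_fun_fubini_tonelli_F _ _ _ _ _ lebn
  (fun w : (spacetime * measurableTypeR R) * Rn R n =>
    (heat_kernel ((w.1.1.2 : R) - (w.1.2 : R)) (subRn w.1.1.1 w.2))%:E
    * g (w.2, w.1.2))%E).
  apply: emeasurable_funM.
    apply: measurable_heat_kernel; last exact: measurable_snd.
      apply: measurable_funB.
        exact: measurableT_comp measurable_snd
          (measurableT_comp measurable_fst measurable_fst).
      exact: measurableT_comp measurable_snd measurable_fst.
    exact: measurableT_comp measurable_fst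
      (measurableT_comp measurable_fst measurable_fst).
  apply: measurableT_comp => //; apply/measurable_fun_pairP; split => /=.
    exact: measurable_snd.
  exact: measurableT_comp measurable_snd measurable_fst.
by move=> w; rewrite mule_ge0// lee_fin heat_kernel_ge0.
Qed.

Lemma measurable_heat_avg_time z : measurable_fun setT
  (fun s : measurableTypeR R => heat_avg g z s).
Proof. exact: measurable_fun_pair2 measurable_heat_avg. Qed.

Lemma measurable_heat_avg_space (t s : measurableTypeR R) :
  measurable_fun setT (fun x => heat_avg g (x, t) s).
Proof.
have h : measurable_fun setT (fun z => heat_avg g z s).
  exact: measurable_fun_pair1 measurable_heat_avg.
exact: measurable_fun_pair1 h.
Qed.

Lemma measurable_heat_avg_integrand z (s : R) : measurable_fun setT (fun y =>
  (heat_kernel ((z.2 : R) - s) (subRn z.1 y))%:E * g (y, s))%E.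
Proof.
apply: emeasurable_funM.
  by apply: measurable_heat_kernel => //; exact: measurable_cst.
exact: (measurable_fun_pair1 (s : measurableTypeR R) mg).
Qed.

(** The domain of integration depends on z. Extending the integrand by 0 outside the measurable set
    0 < s < t makes [duhamel] a partial integral of one measurable function of (z, s). *)
Lemma measurable_duhamel : measurable_fun setT (duhamel g).
Proof.
pose D := [set w : spacetime * measurableTypeR R | (0 < w.2 < w.1.2)%R].
have mD : measurable D.
  rewrite (_ : D = (fun w => (0 < (w.2 : R)) && ((w.2 : R) < w.1.2)) @^-1` [set true]);
    last by apply/seteqP; split => w /=; rewrite /D/=.
  rewrite -[X in measurable X]setTI; apply: measurable_and => //.
    by apply: measurable_fun_ltr => //; exact: measurable_snd.
  apply: measurable_fun_ltr; first exact: measurable_snd.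
  exact: measurableT_comp measurable_snd measurable_fst.
have -> : duhamel g = fubini_F leb
    ((fun w : spacetime * measurableTypeR R => heat_avg g w.1 w.2) \_ D).
  apply/funext => z; rewrite /duhamel integral_mkcond; apply: eq_integral => s _.
  rewrite /patch/= /D; congr (if _ then _ else _).
apply: measurable_fun_fubini_tonelli_F.
  apply: (proj1 (measurable_restrictT _ mD)).
  by apply: measurable_funTS; exact: measurable_heat_avg.
by move=> w; rewrite /patch; case: ifPn => // _; exact: heat_avg_ge0.
Qed.

End measurability.
End duhamel.

(** * Smoothing by the heat flow and the bound on each time slice *)

Section smoothing.
Context {R : realType} {n : nat}.
Local Notation leb := (@lebesgue_measure R).
Local Notation lebn := (@lebesgueRn R n).
Local Notation spacetime := (Rn R n * measurableTypeR R)%type.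
Local Open Scope ereal_scope.
Variables (alpha p : R) (f : spacetime -> \bar R).
Hypotheses (alpha1 : (1 < alpha)%R) (alphap : (alpha < p)%R).
Hypotheses (mf : measurable_fun setT f) (f0 : forall z, 0 <= f z).

Let fpow (r : R) (z : spacetime) := f z `^ r.
Let p1 : (1 < p)%R. Proof. exact: lt_trans alphap. Qed.
Let p0 : (0 < p)%R. Proof. exact: lt_trans p1. Qed.
Let alpha0 : (0 < alpha)%R. Proof. exact: lt_trans alpha1. Qed.

Definition slice_mass (s : R) : \bar R := \int[lebn]_y (f (y, s) `^ p).

(** This is (n/2)(alpha/p - 1/p), the decay exponent of the heat flow from L^(p/alpha) to L^p. *)
Definition heat_decay : R := n%:R / 2 * ((alpha - 1) / p).

(** The factor 2 is the one from [hoelder_interp]. *)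
Definition smoothing_rate (t : R) : R := (2 * (4 * pi * t) `^ (- heat_decay))%R.

Let mfpow r : measurable_fun setT (fpow r).
Proof. exact: measurableT_comp (@measurable_poweR _ r) mf. Qed.

Let fpow0 r z : 0 <= fpow r z. Proof. exact: poweR_ge0. Qed.

Lemma slice_mass_ge0 s : 0 <= slice_mass s.
Proof. by apply: integral_ge0 => y _; exact: fpow0. Qed.

Lemma measurable_slice_mass : measurable_fun setT slice_mass.
Proof.
exact: (@measurable_fun_fubini_tonelli_G _ _ _ _ R lebn (fpow p)).
Qed.

Lemma smoothing_rate_gt0 t : (0 < t)%R -> (0 < smoothing_rate t)%R.
Proof. by move=> t0; rewrite mulr_gt0// powR_gt0// !mulr_gt0// pi_gt0. Qed.

(** Conservation of mass: by Tonelli the kernel is integrated in x first, which gives 1. *)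
Lemma integral_heat_avg (g : spacetime -> \bar R) (t s : R) :
  measurable_fun setT g -> (forall z, 0 <= g z) -> (s < t)%R ->
  \int[lebn]_x heat_avg g (x, t) s = \int[lebn]_y g (y, s).
Proof.
move=> mg g0 st; rewrite /heat_avg /=.
rewrite (@fubini_tonelli _ _ _ _ _ lebn lebn (fun w =>
  (heat_kernel (t - s) (subRn w.1 w.2))%:E * g (w.2, s)))/=; last 2 first.
- apply: emeasurable_funM.
    apply: measurable_heat_kernel => /=; first exact: measurable_cst.
      exact: measurable_fst.
    exact: measurable_snd.
  exact: measurableT_comp (measurable_fun_pair1 (s : measurableTypeR R) mg) measurable_snd.
- by move=> w; rewrite mule_ge0// lee_fin heat_kernel_ge0.
apply: eq_integral => y _.
under eq_integral do rewrite muleC.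
rewrite ge0_integralZl//; last 2 first.
- by apply: measurable_heat_kernel => //; exact: measurable_cst.
- by move=> x _; rewrite lee_fin heat_kernel_ge0.
by rewrite integral_heat_kernell ?subr_gt0// mule1.
Qed.

Lemma heat_avg_le_mass (t s : R) x : (s < t)%R ->
  heat_avg (fpow p) (x, t) s <=
  ((4 * pi * (t - s)) `^ (- (n%:R / 2)))%:E * slice_mass s.
Proof.
move=> st; rewrite -ge0_integralZl//; last 3 first.
- exact: (measurable_fun_pair1 (s : measurableTypeR R) (mfpow p)).
- by move=> y _; exact: fpow0.
- by rewrite lee_fin powR_ge0.
apply: ge0_le_integral => //.
- by move=> y _; rewrite mule_ge0// lee_fin heat_kernel_ge0.
- exact: (measurable_heat_avg_integrand (mfpow p) (x, t : measurableTypeR R)).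
- apply: emeasurable_funM; first exact: measurable_cst.
  exact: (measurable_fun_pair1 (s : measurableTypeR R) (mfpow p)).
- move=> y _; rewrite lee_wpmul2r// lee_fin heat_kernel_le// subr_gt0//.
Qed.

(** Jensen's inequality for the probability density given by the kernel, up to a factor 2: the
    kernel is split into its powers 1 - alpha/p and alpha/p, the second being joined to f^p. *)
Lemma heat_avg_jensen (t s : R) x : (s < t)%R ->
  heat_avg (fpow alpha) (x, t) s <=
  2%:E * heat_avg (fpow p) (x, t) s `^ (alpha / p).
Proof.
move=> st; have th : (0 < alpha / p < 1)%R.
  by rewrite divr_gt0//= ltr_pdivrMr// mul1r.
have ker0 y : 0 <= (heat_kernel (t - s) (subRn x y))%:E.
  by rewrite lee_fin heat_kernel_ge0.
have := @hoelder_interp _ _ R lebn setT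
  (fun y => (heat_kernel (t - s) (subRn x y))%:E)
  (fun y => (heat_kernel (t - s) (subRn x y))%:E * fpow p (y, s)) (alpha / p)
  th measurableT
  (measurable_heat_kernel (measurable_cst _) (measurable_cst _) (@measurable_id _ _ _))
  (measurable_heat_avg_integrand (mfpow p) (x, t : measurableTypeR R) s) ker0.
rewrite integral_heat_kernelr ?subr_gt0// poweR1r mul1e.
move/(_ (fun y => mule_ge0 (ker0 y) (fpow0 p (y, s)))).
apply: le_trans; rewrite le_eqVlt; apply/orP; left; apply/eqP.
apply: eq_integral => y _.
rewrite [in RHS]poweRM// muleA -poweRD_gt0; last 2 first.
- by rewrite subr_gt0; case/andP: th.
- by case/andP: th.
rewrite subrK poweRe1// /fpow -poweRrM mulrCA divff ?gt_eqF// mulr1//.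
Qed.

(* [Y `^ (alpha / p - 1)] is [+oo] when [Y = +oo] and [0] when [Y = 0], so the
   bound is valid, and stable under integration in [x], in these cases too. *)
Lemma heat_avg_smoothing (t s : R) x : (s < t)%R ->
  heat_avg (fpow alpha) (x, t) s <=
  ((smoothing_rate (t - s))%:E * slice_mass s `^ (alpha / p)) `^ (1 - p^-1) *
  ((smoothing_rate (t - s))%:E * slice_mass s `^ (alpha / p - 1) *
    heat_avg (fpow p) (x, t) s) `^ (p^-1).
Proof.
move=> st; set Y := slice_mass s; set b := (smoothing_rate (t - s))%:E.
set P := heat_avg (fpow p) (x, t) s.
have P0 : 0 <= P by exact: heat_avg_ge0.
have Y0 : 0 <= Y by exact: slice_mass_ge0.
have b_gt0 : 0 < b by rewrite lte_fin smoothing_rate_gt0 ?subr_gt0.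
have b0 := ltW b_gt0.
have pV : (0 < p^-1)%R by rewrite invr_gt0.
have pV1 : (0 < 1 - p^-1)%R by rewrite subr_gt0 invf_lt1.
have al0 : (0 < (alpha - 1) / p)%R by rewrite divr_gt0// subr_gt0.
(* Of the exponent alpha/p given by Jensen, the part (alpha - 1)/p is spent on the supremum bound of
   the kernel, which produces the rate; the part 1/p stays on the average, to be integrated in x
   later. *)
have bound : heat_avg (fpow alpha) (x, t) s <=
    b * (Y `^ ((alpha - 1) / p) * P `^ (p^-1)).
  apply: (le_trans (heat_avg_jensen _ st)); rewrite -/P.
  rewrite [alpha in (alpha / p)%R](_ : _ = (alpha - 1) + 1)%R; last by ring.
  rewrite mulrDl mul1r poweRD_gt0// /b /smoothing_rate EFinM -!muleA.
  rewrite lee_wpmul2l ?lee_fin// muleA lee_wpmul2r ?poweR_ge0//.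
  apply: (le_trans (le_poweR (ltW al0) P0 (heat_avg_le_mass x st))).
  rewrite poweRM ?lee_fin ?powR_ge0// ?slice_mass_ge0// poweR_EFin -powRrM.
  by rewrite /heat_decay mulNr.
apply: (le_trans bound).
rewrite poweRM ?poweR_ge0// poweRM ?mule_ge0 ?poweR_ge0// (@poweRM _ b)//;
  last exact: poweR_ge0.
rewrite -!poweRrM.
(* The two powers of Y add up to (alpha - 1)/p. As alpha/p - 1 is negative, exponents are added only
   when Y is neither 0 nor +oo, and these two values are settled directly. *)
have [Y_0|Yneq0] := eqVneq Y 0.
  by rewrite Y_0 poweR0r ?gt_eqF// mul0e mule0 !mule_ge0 ?poweR_ge0.
have bE : b `^ (1 - p^-1) * b `^ p^-1 = b by rewrite -poweRD_gt0// subrK poweRe1.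
have [Y_y|Yneqy] := eqVneq Y +oo.
  have [P_0|Pneq0] := eqVneq P 0.
    by rewrite P_0 poweR0r ?gt_eqF// !mule0.
  have e1 : (alpha / p * (1 - p^-1) != 0)%R by rewrite gt_eqF// mulr_gt0// divr_gt0.
  have e2 : ((alpha / p - 1) / p != 0)%R.
    by rewrite lt_eqF// pmulr_llt0// subr_lt0 ltr_pdivrMr// mul1r.
  have e3 : ((alpha - 1) / p != 0)%R by rewrite gt_eqF.
  rewrite Y_y !poweRyr//.
  have Pp : 0 < P `^ p^-1 by rewrite poweR_gt0// lt0e Pneq0.
  rewrite gt0_muley ?poweR_gt0// gt0_muley ?poweR_gt0// gt0_mulye//.
  by rewrite mulyy leey.
have YE : Y `^ ((alpha - 1) / p) =
    Y `^ (alpha / p * (1 - p^-1)) * Y `^ ((alpha / p - 1) / p).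
  rewrite -poweRD.
    by congr (_ `^ _); field; rewrite gt_eqF.
  by rewrite /poweRD_def Yneq0 ge0_fin_numE// ltey Yneqy implybT.
by rewrite YE -{1}bE -[_ * _ * P `^ _]muleA muleACA !muleA.
Qed.

(* Minkowski's integral inequality, by Hoelder's inequality in time with weight
   [smoothing_rate (t - s) * slice_mass s `^ (alpha / p)]. *)
Lemma duhamel_slice_le (t : R) :
  \int[lebn]_x (duhamel (fpow alpha) (x, t) `^ p) <=
  (2 `^ p)%:E * (\int[leb]_(s in `]0%R, t[)
    ((smoothing_rate (t - s))%:E * slice_mass s `^ (alpha / p))) `^ p.
Proof.
set M := \int[leb]_(s in _) _.
have pV : (0 < p^-1)%R by rewrite invr_gt0.
have pV1 : (0 < 1 - p^-1)%R by rewrite subr_gt0 invf_lt1.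
pose b s : \bar R := (smoothing_rate (t - s))%:E.
have b0 s : 0 <= b s by rewrite lee_fin mulr_ge0// powR_ge0.
pose W (s : measurableTypeR R) : \bar R := b s * slice_mass s `^ (alpha / p).
pose V x (s : measurableTypeR R) : \bar R :=
  b s * slice_mass s `^ (alpha / p - 1) * heat_avg (fpow p) (x, t) s.
have W0 s : 0 <= W s by rewrite mule_ge0// poweR_ge0.
have V0 x s : 0 <= V x s by rewrite !mule_ge0 ?poweR_ge0// heat_avg_ge0.
have mb : measurable_fun setT (b : measurableTypeR R -> \bar R).
  apply/measurable_EFinP; apply: measurable_funM; first exact: measurable_cst.
  apply: measurableT_comp (@measurable_powR _ _) _.
  by apply: measurable_funM => //; apply: measurable_funB => //; exact: measurable_cst.
have mY r : measurable_fun setT (fun s : measurableTypeR R => slice_mass s `^ r).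
  exact: measurableT_comp (@measurable_poweR _ r) measurable_slice_mass.
have mW : measurable_fun setT W by exact: emeasurable_funM.
have mV2 : measurable_fun setT (fun w : Rn R n * measurableTypeR R => V w.1 w.2).
  apply: emeasurable_funM.
    exact: measurableT_comp (emeasurable_funM mb (mY (alpha / p - 1)%R)) measurable_snd.
  have mi : measurable_fun setT (fun w : Rn R n * measurableTypeR R =>
      ((w.1, t : measurableTypeR R), w.2)).
    apply: measurable_fun_pair; last exact: measurable_snd.
    by apply: measurable_fun_pair; [exact: measurable_fst|exact: measurable_cst].
  exact: measurableT_comp (measurable_heat_avg (mfpow p) (fpow0 p)) mi.
have mV x : measurable_fun setT (V x) by exact: measurable_fun_pair2 mV2.
have M0 : 0 <= M by apply: integral_ge0 => s _; exact: W0.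
have mD : measurable (`]0%R, t[ : set (measurableTypeR R)) by exact: measurable_itv.
have IV0 x : 0 <= \int[leb]_(s in `]0%R, t[) V x s.
  by apply: integral_ge0 => s _; exact: V0.
(* Hoelder's inequality in s, with exponents 1 - 1/p and 1/p, applied to the two factors of
   [heat_avg_smoothing]; [V] is built so that its integral in x is at most [W]. *)
have step1 x : duhamel (fpow alpha) (x, t) `^ p <=
    (2 `^ p)%:E * (M `^ (p - 1) * \int[leb]_(s in `]0%R, t[) V x s).
  have -> : (2 `^ p)%:E * (M `^ (p - 1) * \int[leb]_(s in `]0%R, t[) V x s) =
      (2%:E * (M `^ (1 - p^-1) * (\int[leb]_(s in `]0%R, t[) V x s) `^ p^-1)) `^ p.
    rewrite (@poweRM _ 2%:E) ?mule_ge0 ?poweR_ge0// poweRM ?poweR_ge0//.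
    rewrite -!poweRrM mulVf ?gt_eqF// poweRe1// mulrBl mul1r mulVf ?gt_eqF//.
  apply: le_poweR; [exact: ltW|exact: duhamel_ge0|].
  apply: le_trans (hoelder_interp leb _ mD _ _ W0 (V0 x)); last 3 first.
  - by rewrite pV/= invf_lt1.
  - exact: measurable_funTS mW.
  - exact: measurable_funTS (mV x).
  apply: ge0_le_integral => //.
  - by move=> s _; exact: heat_avg_ge0.
  - apply: measurable_funTS.
    exact: (measurable_heat_avg_time (mfpow alpha) (fpow0 alpha)).
  - apply: measurable_funTS; apply: emeasurable_funM.
      exact: measurableT_comp (@measurable_poweR _ _) mW.
    exact: measurableT_comp (@measurable_poweR _ _) (mV x).
  - move=> s /=; rewrite in_itv/= => /andP[s0 st].
    exact: heat_avg_smoothing.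
pose V' (w : Rn R n * measurableTypeR R) := V w.1 w.2 * (\1_(`]0%R, t[) w.2)%:E.
have mV' : measurable_fun setT V'.
  apply: emeasurable_funM => //; apply/measurable_EFinP.
  exact: measurableT_comp (measurable_indic _) measurable_snd.
have V'0 w : 0 <= V' w by rewrite mule_ge0// lee_fin.
have IVE : (fun x => \int[leb]_(s in `]0%R, t[) V x s) = fubini_F leb V'.
  apply/funext => x; rewrite integral_mkcond /fubini_F; apply: eq_integral => s _.
  by rewrite epatch_indic.
have mIV : measurable_fun setT (fun x => \int[leb]_(s in `]0%R, t[) V x s).
  by rewrite IVE; exact: measurable_fun_fubini_tonelli_F.
apply: (@le_trans _ _ (\int[lebn]_x
    ((2 `^ p)%:E * (M `^ (p - 1) * \int[leb]_(s in `]0%R, t[) V x s)))).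
  apply: ge0_le_integral => //.
  - by move=> x _; exact: poweR_ge0.
  - apply: measurableT_comp (@measurable_poweR _ p) _.
    exact: measurable_fun_pair1 (measurable_duhamel (mfpow alpha) (fpow0 alpha)).
  - apply: emeasurable_funM; first exact: measurable_cst.
    by apply: emeasurable_funM => //; exact: measurable_cst.
have MVge0 x : 0 <= M `^ (p - 1) * \int[leb]_(s in `]0%R, t[) V x s.
  by rewrite mule_ge0// poweR_ge0.
rewrite (ge0_integralZl _ measurableT) //; last first.
  by apply: emeasurable_funM => //; exact: measurable_cst.
rewrite (ge0_integralZl _ measurableT) //; last by rewrite poweR_ge0.
rewrite lee_wpmul2l ?lee_fin ?powR_ge0//.
have -> : M `^ p = M `^ (p - 1) * M.
  by rewrite -[X in _ * X]poweRe1// -poweRD_gt0 ?subr_gt0// subrK.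
rewrite lee_wpmul2l ?poweR_ge0//.
rewrite IVE /fubini_F fubini_tonelli// -/M.
apply: (@le_trans _ _ (\int[leb]_(s in `]0%R, t[) \int[lebn]_x V x s)).
  rewrite [leRHS]integral_mkcond le_eqVlt; apply/orP; left; apply/eqP.
  apply: eq_integral => s _; rewrite /V' /patch /= indicE.
  case: (s \in _); first by under eq_integral do rewrite mule1.
  by under eq_integral do rewrite mule0; rewrite integral0.
apply: ge0_le_integral => //.
- by move=> s _; exact: integral_ge0.
- apply: measurable_funTS.
  exact: (@measurable_fun_fubini_tonelli_G _ _ _ _ R lebn
    (fun w => V w.1 w.2) mV2 (fun w => V0 w.1 w.2)).
- exact: measurable_funTS.
move=> s /=; rewrite in_itv/= => /andP[s0 st].
(* Integrating in x turns the average into [slice_mass], so it remains to see that Y^(alpha/p - 1)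
   times Y is at most Y^(alpha/p), including Y = 0 and Y = +oo. *)
rewrite ge0_integralZl//; last 3 first.
- exact: (measurable_heat_avg_space (mfpow p) (fpow0 p)).
- by move=> x _; exact: heat_avg_ge0.
- by rewrite mule_ge0// poweR_ge0.
rewrite integral_heat_avg// -/(slice_mass s) -muleA lee_wpmul2l//.
have := slice_mass_ge0 s; move: (slice_mass s) => Y Y0.
have pal : (alpha / p - 1 != 0)%R.
  by rewrite lt_eqF// subr_lt0 ltr_pdivrMr// mul1r.
have [->|Yneqy] := eqVneq Y +oo.
  by rewrite poweRyr// mulyy poweRyr// gt_eqF// divr_gt0.
have [->|Yneq0] := eqVneq Y 0; first by rewrite mule0 poweR_ge0.
rewrite -[X in _ * X]poweRe1// -poweRD ?subrK//.
by rewrite /poweRD_def Yneq0 ge0_fin_numE// ltey Yneqy implybT.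
Qed.

End smoothing.

(** * Integrals of powers over a time interval *)

Section power_integrals.
Context {R : realType}.
Local Notation leb := (@lebesgue_measure R).

(** The integrand may blow up at both ends. The fundamental theorem of calculus is therefore used on
    compact subintervals, where F(d) - F(c) <= C, and monotone convergence exhausts the open
    interval. *)
Lemma integral_derive_le (f F : R -> R) (a b C : R) :
  (forall x, a < x < b -> 0 <= f x) ->
  (forall x, a < x < b -> {for x, continuous f}) ->
  (forall x, a < x < b -> is_derive x 1 F (f x)) ->
  (forall x, a < x < b -> 0 <= F x <= C) -> 0 <= C ->
  (\int[leb]_(x in `]a, b[) (f x)%:E <= C%:E)%E.
Proof.
move=> f0 cf dF FC C0.
pose J (m : nat) : set R := `[a + m.+1%:R^-1, b - m.+1%:R^-1]%classic.
have inv_gt0 (m : nat) : 0 < m.+1%:R^-1 :> R by rewrite invr_gt0.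
have Jab m x : J m x -> a < x < b.
  rewrite /J/= in_itv/= => /andP[ax xb]; apply/andP; split.
    by apply: lt_le_trans ax; rewrite ltrDl.
  by apply: (le_lt_trans xb); rewrite ltrBlDr ltrDl.
have -> : `]a, b[%classic = \bigcup_m J m.
  apply/seteqP; split => [x /=|x [m _] /Jab]; rewrite ?in_itv//= => /andP[ax xb].
  have [m mx] : exists m, (m.+1%:R^-1 < Num.min (x - a) (b - x)).
    have : 0 < Num.min (x - a) (b - x) by rewrite lt_min !subr_gt0 ax xb.
    by move=> /ltr_add_invr[m]; rewrite add0r; exists m.
  move: mx; rewrite lt_min => /andP[m1 m2]; exists m => //.
  by rewrite /J/= in_itv/= -lerBrDl (ltW m1) lerBrDr -lerBrDl (ltW m2).
have cJ m : {within J m, continuous f}.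
  by apply: continuous_in_subspaceT => x /set_mem/Jab; exact: cf.
have cvgI : ((\int[leb]_(x in J m) (f x)%:E)%E @[m --> \oo] -->
    (\int[leb]_(x in \bigcup_m J m) (f x)%:E)%E)%classic.
  apply: ge0_nondecreasing_set_cvg_integral.
  - move=> m1 m2 m12; apply/subsetPset => x; rewrite /J/= !in_itv/= => /andP[ax xb].
    have m21 : m2.+1%:R^-1 <= m1.+1%:R^-1 :> R by rewrite lef_pV2 ?posrE// ler_nat ltnS.
    rewrite (le_trans _ ax) ?lerD2l//= (le_trans xb)// lerB//.
  - by move=> m; exact: measurable_itv.
  - move=> m; apply/measurable_EFinP.
    apply: subspace_continuous_measurable_fun => //; exact: measurable_itv.
  - by move=> m x /Jab; rewrite lee_fin; exact: f0.
rewrite -(cvg_lim _ cvgI)//; apply: lime_le; first by apply/cvg_ex; eexists; exact: cvgI.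
apply: nearW => m; rewrite /J; set c := a + _; set d := b - _.
(* For small [m] the compact subinterval may be empty or a single point. *)
have [cd|dc] := ltP c d; last first.
  move: dc; rewrite le_eqVlt => /predU1P[->|dc].
    by rewrite set_itv1 integral_set1 lee_fin.
  by rewrite set_itv_ge ?integral_set0 ?lee_fin// bnd_simp -ltNge.
have ca : a < c by rewrite /c ltrDl.
have db : d < b by rewrite /d ltrBlDr ltrDl.
have cF x : a < x < b -> {for x, continuous F}.
  move=> /dF [dFx _]; apply: differentiable_continuous.
  exact/derivable1_diffP.
rewrite (continuous_FTC2 cd (cJ m) (F := F)).
- have /FC/andP[Fc0 _] : a < c < b by rewrite ca (lt_trans cd).
  have /FC/andP[_ FdC] : a < d < b by rewrite db (lt_trans ca).
  by rewrite -EFinB lee_fin; lra.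
- split.
  + move=> x; rewrite in_itv/= => /andP[cx xd].
    by have [] : is_derive x 1 F (f x) by apply: dF; rewrite (lt_trans ca)//= (lt_trans xd).
  + by apply: cvg_at_right_filter; apply: cF; rewrite ca (lt_trans cd).
  + by apply: cvg_at_left_filter; apply: cF; rewrite db (lt_trans ca).
- move=> x; rewrite in_itv/= => /andP[cx xd]; rewrite derive1E.
  by have [] : is_derive x 1 F (f x) by apply: dF; rewrite (lt_trans ca)//= (lt_trans xd).
Qed.

Lemma powR_continuous_at (r x : R) : 0 < x -> {for x, continuous (@powR R ^~ r)}.
Proof.
move=> x0; apply: differentiable_continuous; apply/derivable1_diffP.
by have [] := is_derive1_powR r x0.
Qed.

Lemma integral_powR_le (r t : R) : -1 < r -> 0 < t ->
  (\int[leb]_(s in `]0%R, t[) (s `^ r)%:E <= (t `^ (r + 1) / (r + 1))%:E)%E.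
Proof.
move=> r1 t0; have r10 : 0 < r + 1 by rewrite -ltrBlDr sub0r.
apply: (@integral_derive_le _ (fun s => s `^ (r + 1) / (r + 1))).
- by move=> x _; exact: powR_ge0.
- by move=> x /andP[x0 _]; exact: powR_continuous_at.
- move=> x /andP[x0 _].
  have -> : (fun s => s `^ (r + 1) / (r + 1)) =
      (r + 1)^-1 \*: (@powR R ^~ (r + 1)).
    by apply/funext => s /=; rewrite mulrC.
  have h := is_derive1_powR (r + 1) x0.
  apply: is_derive_eq (is_deriveZ (r + 1)^-1 h) _.
  by rewrite addrK /GRing.scale/= mulrA mulVf ?gt_eqF// mul1r.
- move=> x /andP[x0 xt]; rewrite divr_ge0 ?powR_ge0 ?(ltW r10)//=.
  by rewrite ler_pM2r ?invr_gt0// ge0_ler_powR// ?nnegrE ltW.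
- by rewrite divr_ge0 ?powR_ge0// ltW.
Qed.

(** The primitive of the reflected power is written out, in place of a change of variables. *)
Lemma integral_powR_rev_le (r t : R) : -1 < r -> 0 < t ->
  (\int[leb]_(s in `]0%R, t[) ((t - s) `^ r)%:E <= (t `^ (r + 1) / (r + 1))%:E)%E.
Proof.
move=> r1 t0; have r10 : 0 < r + 1 by rewrite -ltrBlDr sub0r.
apply: (@integral_derive_le _
  (fun s => (t `^ (r + 1) - (t - s) `^ (r + 1)) / (r + 1))).
- by move=> x _; exact: powR_ge0.
- move=> x /andP[_ xt];
  apply: (@continuous_comp _ _ _ (fun s => t - s) (@powR R ^~ r)).
    by apply: continuousB; [exact: cst_continuous|exact: cvg_id].
  by apply: powR_continuous_at; rewrite subr_gt0.
- move=> x /andP[_ xt].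
  have tx0 : 0 < t - x by rewrite subr_gt0.
  have -> : (fun s => (t `^ (r + 1) - (t - s) `^ (r + 1)) / (r + 1)) =
      (r + 1)^-1 \*: (cst (t `^ (r + 1)) - ((@powR R ^~ (r + 1)) \o (cst t - id))).
    by apply/funext => s /=; rewrite mulrC.
  have h := is_derive1_powR (r + 1) tx0.
  have hid : is_derive x (1 : R) (cst t - id : R -> R) (-1).
    rewrite -(sub0r (1 : R)); exact: is_deriveB (is_derive_cst t x (1 : R)) (is_derive_id x (1 : R)).
  have hcst := is_derive_cst (t `^ (r + 1) : R) x (1 : R).
  have hc := @is_derive1_comp _ _ _ x _ _ h hid.
  have hB := is_deriveB hcst hc.
  have hZ := is_deriveZ (r + 1)^-1 hB.
  apply: (is_derive_eq hZ).
  by rewrite addrK /GRing.scale/=; field; rewrite gt_eqF.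
- move=> x /andP[x0 xt].
  rewrite divr_ge0 ?(ltW r10) ?subr_ge0 ?ge0_ler_powR ?nnegrE//=; try lra.
  by rewrite ler_pM2r ?invr_gt0// lerBlDr lerDl powR_ge0.
- by rewrite divr_ge0 ?powR_ge0// ltW.
Qed.

End power_integrals.

(** * The nonlinear estimate *)

Section energy.
Context {R : realType} {n : nat}.
Local Notation leb := (@lebesgue_measure R).
Local Notation lebn := (@lebesgueRn R n).
Local Notation spacetime := (Rn R n * measurableTypeR R)%type.

(** The q-th power of the norm of X for nonnegative [f], as [mixed_normE] makes precise. Without the
    outer root, a short time appears as a plain factor T^r. *)
Definition energy (p q k T : R) (f : spacetime -> \bar R) : \bar R :=
  (\int[leb]_(t in `]0%R, T[) (slice_mass p f t `^ (q / p) * (t `^ k)%:E))%E.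

Section nonlinear_estimate.
Variables alpha k p q : R.
Hypotheses (alpha1 : 1 < alpha) (k0 : 0 < k) (alphap : alpha < p) (alphaq : alpha < q).
(** With gamma below, these are [heat_decay] and k alpha/q divided by 1 - alpha/q: the exponents
    that Hoelder's inequality in time, with exponents 1 - alpha/q and alpha/q, puts on t - s and on
    s. *)
Let beta := @heat_decay R n alpha p * (q / (q - alpha)).
Let gamma := k * alpha / (q - alpha).
Hypotheses (beta1 : beta < 1) (gamma1 : gamma < 1).
Hypothesis exponent : -1 < k + (q - alpha) * (1 - beta - gamma).

Let alpha0 : 0 < alpha. Proof. exact: lt_trans alpha1. Qed.
Let p0 : 0 < p. Proof. exact: lt_trans alphap. Qed.
Let q0 : 0 < q. Proof. exact: lt_trans alphaq. Qed.
Let qa0 : 0 < q - alpha. Proof. by rewrite subr_gt0. Qed.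

Let beta0 : 0 <= beta.
Proof.
rewrite /beta /heat_decay; apply: mulr_ge0; first apply: mulr_ge0.
- exact: divr_ge0.
- by apply: divr_ge0; [rewrite subr_ge0 ltW|exact: ltW].
- by apply: divr_ge0; exact: ltW.
Qed.

Let gamma0 : 0 <= gamma.
Proof. by rewrite divr_ge0 ?mulr_ge0 ?(ltW k0) ?(ltW alpha0) ?(ltW qa0). Qed.

(** An upper bound for the Beta function at (1 - beta, 1 - gamma), found by cutting the interval at
    t/2. *)
Let time_const := 2 `^ beta / (1 - gamma) + 2 `^ gamma / (1 - beta).

Let time_const_ge0 : 0 <= time_const.
Proof. by rewrite addr_ge0// divr_ge0 ?powR_ge0// subr_ge0 ltW. Qed.

(** At least one of s and t - s is >= t/2, so one of the two singular factors can be frozen at t/2;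
    each remaining term has a single singularity. *)
Let time_weight_le (t s : R) : 0 < s < t ->
  (t - s) `^ (- beta) * s `^ (- gamma) <=
  (t / 2) `^ (- beta) * s `^ (- gamma) + (t / 2) `^ (- gamma) * (t - s) `^ (- beta).
Proof.
move=> /andP[s0 st]; have t0 : 0 < t by exact: lt_trans st.
have t20 : 0 < t / 2 by rewrite divr_gt0.
have antitone (r x y : R) : 0 <= r -> 0 < x -> x <= y -> y `^ (- r) <= x `^ (- r).
  move=> r0 x0 xy; rewrite !powRN lef_pV2 ?posrE ?powR_gt0//.
    by rewrite ge0_ler_powR ?nnegrE// ltW// (lt_le_trans x0).
  exact: lt_le_trans xy.
have [h|h] := leP (t / 2) s.
  rewrite -[leLHS]add0r lerD ?mulr_ge0 ?powR_ge0// mulrC ler_wpM2r ?powR_ge0//.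
  exact: antitone.
rewrite -[leLHS]addr0 lerD ?mulr_ge0 ?powR_ge0// ler_wpM2r ?powR_ge0//.
by apply: antitone => //; lra.
Qed.

Let integral_time_weight_le (t : R) : 0 < t ->
  (\int[leb]_(s in `]0%R, t[) ((t - s) `^ (- beta) * s `^ (- gamma))%:E <=
   (time_const * t `^ (1 - beta - gamma))%:E)%E.
Proof.
move=> t0.
have ms (r : R) : measurable_fun setT (fun s : R => s `^ r) by exact: measurable_powR.
have mts (r : R) : measurable_fun setT (fun s : R => (t - s) `^ r).
  apply: measurableT_comp (ms r) _.
  by apply: measurable_funB => //; exact: measurable_cst.
have mcs (c : R) (h : R -> R) : measurable_fun setT h ->
    measurable_fun `]0%R, t[ (fun s => (c * h s)%:E).
  move=> mh; apply: measurable_funTS; apply/measurable_EFinP.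
  by apply: measurable_funM => //; exact: measurable_cst.
have ->: (time_const * t `^ (1 - beta - gamma))%:E =
   (((t / 2) `^ (- beta))%:E * (t `^ (- gamma + 1) / (- gamma + 1))%:E +
    ((t / 2) `^ (- gamma))%:E * (t `^ (- beta + 1) / (- beta + 1))%:E)%E.
  rewrite -!EFinM -EFinD; congr (_%:E).
  have h (r r' : R) : (t / 2) `^ (- r) * (t `^ (- r' + 1) / (- r' + 1)) =
      2 `^ r / (1 - r') * t `^ (1 - r - r').
    rewrite powRM ?invr_ge0 ?(ltW t0)// -powR_inv1// -powRrM mulN1r opprK.
    rewrite (_ : 1 - r - r' = - r + (- r' + 1)); last by ring.
    rewrite (@powRD _ t (- r)) ?(gt_eqF t0) ?implybT//.
    by rewrite -(addrC (- r') 1); ring.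
  by rewrite !h /time_const mulrDl (addrAC 1 (- gamma)).
apply: (@le_trans _ _ (\int[leb]_(s in `]0%R, t[)
   (((t / 2) `^ (- beta) * s `^ (- gamma))%:E +
    ((t / 2) `^ (- gamma) * (t - s) `^ (- beta))%:E))%E).
  apply: ge0_le_integral => //.
  - by move=> s _; rewrite lee_fin mulr_ge0 ?powR_ge0.
  - by apply: measurable_funTS; apply/measurable_EFinP;
      exact: measurable_funM (mts _) (ms _).
  - by apply: emeasurable_funD; exact: mcs.
  - move=> s /=; rewrite in_itv/= => st.
    by rewrite -EFinD lee_fin; exact: time_weight_le.
rewrite ge0_integralD//; last 4 first.
- by move=> s _; rewrite lee_fin mulr_ge0 ?powR_ge0.
- exact: mcs.
- by move=> s _; rewrite lee_fin mulr_ge0 ?powR_ge0.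
- exact: mcs.
have Z (c : R) (h : R -> R) : 0 <= c -> measurable_fun setT h -> (forall s, 0 <= h s) ->
    (\int[leb]_(s in `]0%R, t[) (c * h s)%:E =
     c%:E * \int[leb]_(s in `]0%R, t[) (h s)%:E)%E.
  move=> c0 mh h0; under eq_integral do rewrite EFinM.
  apply: ge0_integralZl => //.
  - by apply: measurable_funTS; apply/measurable_EFinP.
  - by move=> s _; rewrite lee_fin.
rewrite !Z ?powR_ge0//; try by move=> s; exact: powR_ge0.
apply: leeD; rewrite lee_wpmul2l ?lee_fin ?powR_ge0//.
- by apply: integral_powR_le => //; rewrite ltrN2.
- by apply: integral_powR_rev_le => //; rewrite ltrN2.
Qed.

Let growth := (q - alpha) * (1 - beta - gamma).

(** By [duhamel_slice_le] and Hoelder in time, the slice of the Duhamel term at time t, to the power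
    q/p, is at most a constant times t^growth E^alpha. This is integrated against t^k, which is
    possible since k + growth > -1, and leaves a positive power of T. *)
Lemma energy_duhamel_le : exists2 C : R, 0 <= C & forall T f, 0 < T ->
  measurable_fun setT f -> (forall z, 0 <= f z)%E ->
  (energy p q k T (duhamel (fun z => f z `^ alpha)) <=
   (C * T `^ (k + growth + 1))%:E * energy p q k T f `^ alpha)%E.
Proof.
(* [smoothing_rate] at time t is c times t to the power -[heat_decay]. In [C1], the first 2^q is the
   2^p of [duhamel_slice_le] to the power q/p, and the 2 beside c comes from [hoelder_interp]. *)
pose c := 2 * (4 * pi) `^ (- @heat_decay R n alpha p).
pose C1 := 2 `^ q * ((2 * c) `^ q * time_const `^ (q - alpha)).
have c0 : 0 <= c by rewrite mulr_ge0 ?powR_ge0.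
have C10 : 0 <= C1 by rewrite !mulr_ge0 ?powR_ge0.
have r0 : 0 < k + growth + 1 by rewrite -ltrBlDr sub0r.
exists (C1 / (k + growth + 1)); first by rewrite divr_ge0// ltW.
move=> T f T0 mf f0; set E := energy p q k T f.
have mB : measurable_fun setT (fun s : measurableTypeR R =>
    (slice_mass p f s `^ (q / p) * (s `^ k)%:E)%E).
  apply: emeasurable_funM.
    exact: measurableT_comp (@measurable_poweR _ _) (measurable_slice_mass p mf).
  by apply/measurable_EFinP; exact: measurable_powR.
have B0 (s : R) : (0 <= slice_mass p f s `^ (q / p) * (s `^ k)%:E)%E.
  by rewrite mule_ge0 ?poweR_ge0// lee_fin powR_ge0.
have E0 : (0 <= E)%E by exact: integral_ge0.
have slice t : 0 < t < T ->
    (slice_mass p (duhamel (fun z => f z `^ alpha)) t `^ (q / p) <=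
     (C1 * t `^ growth)%:E * E `^ alpha)%E.
  move=> /andP[t0 tT].
  set M := (\int[leb]_(s in `]0%R, t[)
    ((smoothing_rate (n := n) alpha p (t - s))%:E * slice_mass p f s `^ (alpha / p)))%E.
  have th : 0 < alpha / q < 1 by rewrite divr_gt0//= ltr_pdivrMr// mul1r.
  have th1 : 0 <= 1 - alpha / q by rewrite subr_ge0 ltW//; case/andP: th.
  pose A (s : measurableTypeR R) : \bar R := ((t - s) `^ (- beta) * s `^ (- gamma))%:E.
  pose B (s : measurableTypeR R) : \bar R :=
    (slice_mass p f s `^ (q / p) * (s `^ k)%:E)%E.
  have A0 s : (0 <= A s)%E by rewrite lee_fin mulr_ge0 ?powR_ge0.
  have mA : measurable_fun setT A.
    apply/measurable_EFinP; apply: measurable_funM; last exact: measurable_powR.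
    apply: measurableT_comp (@measurable_powR _ _) _.
    by apply: measurable_funB => //; exact: measurable_cst.
  have mD : measurable (`]0%R, t[ : set (measurableTypeR R)) by exact: measurable_itv.
  have M0 : (0 <= M)%E.
    by apply: integral_ge0 => s _; rewrite mule_ge0 ?poweR_ge0// lee_fin mulr_ge0 ?powR_ge0.
  have ME : (M <= (2 * c)%:E * ((time_const * t `^ (1 - beta - gamma))%:E `^ (1 - alpha / q)
      * E `^ (alpha / q)))%E.
    (* The power 1 - alpha/q of [A] restores the decay rate in t - s, and its power of s cancels the
       s^(k alpha/q) contributed by [B]. *)
    have -> : M = (c%:E * \int[leb]_(s in `]0%R, t[)
        (A s `^ (1 - alpha / q) * B s `^ (alpha / q)))%E.
      rewrite -ge0_integralZl//; last 2 first.
      - apply: measurable_funTS; apply: emeasurable_funM;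
          exact: measurableT_comp (@measurable_poweR _ _) _.
      - by move=> s _; rewrite mule_ge0 ?poweR_ge0.
      apply: eq_integral => s; rewrite inE/= in_itv/= => /andP[s0 st].
      rewrite /A /B poweRM ?poweR_ge0 ?lee_fin ?powR_ge0// -poweRrM !poweR_EFin.
      rewrite powRM ?powR_ge0// -!powRrM.
      rewrite (_ : - beta * (1 - alpha / q) = - @heat_decay R n alpha p); last first.
        by rewrite /beta; field; rewrite (gt_eqF q0) gt_eqF.
      rewrite (_ : - gamma * (1 - alpha / q) = - (k * (alpha / q))); last first.
        by rewrite /gamma; field; rewrite (gt_eqF q0) gt_eqF.
      rewrite (_ : q / p * (alpha / q) = alpha / p); last first.
        by field; rewrite (gt_eqF q0) gt_eqF.
      rewrite /smoothing_rate powRM ?subr_ge0 ?(ltW st) ?mulr_ge0 ?pi_ge0//.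
      rewrite (muleC (slice_mass p f s `^ _)%E) !muleA -!EFinM; congr (_%:E * _)%E.
      have sE : s `^ (- (k * (alpha / q))) * s `^ (k * (alpha / q)) = 1.
        by rewrite powRN mulVf// gt_eqF// powR_gt0.
      by rewrite mulrA -/c -!mulrA sE mulr1.
    rewrite (_ : (2 * c)%:E = (c%:E * 2%:E)%E); last by rewrite -EFinM mulrC.
    rewrite -muleA lee_wpmul2l ?lee_fin//.
    apply: (le_trans (hoelder_interp leb th mD (measurable_funTS mA) (measurable_funTS mB) A0 B0)).
    rewrite lee_wpmul2l ?lee_fin//.
    apply: lee_pmul; rewrite ?poweR_ge0//.
      by apply: le_poweR => //; [exact: integral_ge0|exact: integral_time_weight_le].
    apply: le_poweR; [by case/andP: th => /ltW|exact: integral_ge0|].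
    apply: ge0_subset_integral => //.
    - exact: measurable_funTS.
    - by apply: subset_itvl; rewrite bnd_simp ltW.
  apply: (@le_trans _ _ (((2 `^ p)%:E * M `^ p) `^ (q / p)))%E.
    apply: le_poweR; first by rewrite divr_ge0// ltW.
      by apply: slice_mass_ge0 => z; exact: duhamel_ge0.
    exact: duhamel_slice_le.
  rewrite poweRM ?poweR_ge0 ?lee_fin ?powR_ge0// -poweRrM poweR_EFin -powRrM.
  rewrite mulrCA divff ?gt_eqF// mulr1.
  apply: (@le_trans _ _ ((2 `^ q)%:E * ((2 * c)%:E *
    ((time_const * t `^ (1 - beta - gamma))%:E `^ (1 - alpha / q)
      * E `^ (alpha / q))) `^ q)%E).
    by rewrite lee_wpmul2l ?lee_fin ?powR_ge0//; apply: le_poweR => //; exact: ltW.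
  rewrite !poweRM ?mule_ge0 ?poweR_ge0 ?lee_fin ?mulr_ge0 ?powR_ge0//.
  rewrite -!poweRrM !mulrBl mul1r divfK ?gt_eqF// !poweR_EFin.
  rewrite (@powRM _ time_const) ?powR_ge0// -powRrM !muleA -!EFinM /C1 /growth (mulrC (q - alpha)).
  by rewrite !mulrA.
apply: (@le_trans _ _ (\int[leb]_(t in `]0%R, T[)
    (((C1)%:E * E `^ alpha) * (t `^ (growth + k))%:E))%E).
  apply: ge0_le_integral => //.
  - by move=> t _; rewrite mule_ge0 ?poweR_ge0// lee_fin powR_ge0.
  - apply: measurable_funTS; apply: emeasurable_funM; last first.
      by apply/measurable_EFinP; exact: measurable_powR.
    apply: measurableT_comp (@measurable_poweR _ _) (measurable_slice_mass p _).
    apply: measurable_duhamel.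
      exact: measurableT_comp (@measurable_poweR _ _) mf.
    by move=> z; exact: poweR_ge0.
  - apply: measurable_funTS; apply: emeasurable_funM; first exact: measurable_cst.
    by apply/measurable_EFinP; exact: measurable_powR.
  - move=> t /=; rewrite in_itv/= => tT; have /andP[t0 _] := tT.
    apply: (le_trans (lee_wpmul2r _ (slice t tT))); first by rewrite lee_fin powR_ge0.
    rewrite powRD ?(gt_eqF t0) ?implybT// !EFinM.
    by rewrite -!muleA; rewrite (muleCA (t `^ growth)%:E).
rewrite ge0_integralZl//; last 3 first.
- by apply: measurable_funTS; apply/measurable_EFinP; exact: measurable_powR.
- by move=> t _; rewrite lee_fin powR_ge0.
- by rewrite mule_ge0 ?poweR_ge0.
apply: (le_trans (lee_wpmul2l _ (integral_powR_le _ T0))).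
- by rewrite mule_ge0 ?poweR_ge0.
- by rewrite addrC.
rewrite (addrC growth k) [X in (X <= _)%E]muleAC -EFinM.
by rewrite mulrA (mulrAC C1).
Qed.

End nonlinear_estimate.
End energy.
(** Every u_j is at most (L/c)^(1/r), where L is the limit on the right, so the limit of the u_j is
    too. The factor c will be the weight t^k, or 1. *)
Lemma poweR_limn_le {R : realType} (u : nat -> \bar R) (r c : R) :
  0 < r -> 0 < c -> (forall j, 0 <= u j)%E -> nondecreasing_seq u ->
  ((limn u) `^ r * c%:E <= limn (fun j => u j `^ r * c%:E))%E.
Proof.
move=> r0 c0 u0 ndu; set L := (X in (_ <= X)%E).
have ndur : nondecreasing_seq (fun j => u j `^ r * c%:E)%E.
  move=> i j ij; rewrite lee_wpmul2r ?lee_fin ?(ltW c0)//.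
  by apply: le_poweR => //; [exact: ltW|exact: ndu].
have leL j : (u j `^ r * c%:E <= L)%E.
  apply: lime_ge; first exact: ereal_nondecreasing_is_cvgn.
  by exists j => // i /= ji; exact: ndur.
have cK : (c%:E * c^-1%:E = 1)%E by rewrite -EFinM divff// gt_eqF.
have L0 : (0 <= L)%E.
  by apply: le_trans (leL 0%N); rewrite mule_ge0 ?poweR_ge0// lee_fin ltW.
have cV0 : (0 <= c^-1%:E)%E by rewrite lee_fin invr_ge0 ltW.
have uL j : (u j <= (L * c^-1%:E) `^ r^-1)%E.
  rewrite -[leLHS]poweRe1// -(divff (lt0r_neq0 r0)) poweRrM.
  apply: le_poweR; [by rewrite invr_ge0 ltW|exact: poweR_ge0|].
  by rewrite -[leLHS]mule1 -cK muleA lee_wpmul2r.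
have limL : (limn u <= (L * c^-1%:E) `^ r^-1)%E.
  by apply: lime_le; [exact: ereal_nondecreasing_is_cvgn|exact: nearW].
have lim0 : (0 <= limn u)%E.
  by apply: lime_ge; [exact: ereal_nondecreasing_is_cvgn|exact: nearW].
have := le_poweR (ltW r0) lim0 limL.
rewrite -poweRrM mulVf ?lt0r_neq0// poweRe1 ?mule_ge0// => h.
apply: (le_trans (lee_wpmul2r _ h)); first by rewrite lee_fin ltW.
by rewrite -muleA (muleC c^-1%:E) cK mule1.
Qed.

(** * Properties of the energy *)

Section energy_theory.
Context {R : realType} {n : nat}.
Local Notation leb := (@lebesgue_measure R).
Local Notation lebn := (@lebesgueRn R n).
Local Notation spacetime := (Rn R n * measurableTypeR R)%type.
Variables p q k T : R.
Hypotheses (p0 : 0 < p) (q0 : 0 < q).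
Implicit Types f g : spacetime -> \bar R.
Local Notation energy := (energy p q k T).

Let qp0 : 0 < q / p. Proof. exact: divr_gt0. Qed.

Lemma measurable_slab : measurable (slab T : set spacetime).
Proof.
have -> : slab T = setT `*` `]0%R, T[%classic :> set spacetime.
  by apply/seteqP; split => z; rewrite /slab/= in_itv/=; [split|case].
exact: measurableX.
Qed.

Lemma measurable_energy_integrand f : measurable_fun setT f ->
  measurable_fun setT (fun t : measurableTypeR R =>
    slice_mass p f t `^ (q / p) * (t `^ k)%:E)%E.
Proof.
move=> mf; apply: emeasurable_funM.
  exact: measurableT_comp (@measurable_poweR _ _) (measurable_slice_mass p mf).
by apply/measurable_EFinP; exact: measurable_powR.
Qed.

Lemma measurable_slice_integrand f t : measurable_fun setT f ->
  measurable_fun setT (fun x => f (x, t) `^ p)%E.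
Proof.
move=> mf; apply: measurableT_comp (@measurable_poweR _ _) _.
exact: (measurable_fun_pair1 (t : measurableTypeR R) mf).
Qed.

Lemma energy_ge0 f : (0 <= energy f)%E.
Proof. by apply: integral_ge0 => t _; rewrite mule_ge0 ?poweR_ge0// lee_fin powR_ge0. Qed.

Lemma slice_mass_le f g t : measurable_fun setT f -> measurable_fun setT g ->
  (forall x, 0 <= f (x, t))%E -> (forall x, f (x, t) <= g (x, t))%E ->
  (slice_mass p f t <= slice_mass p g t)%E.
Proof.
move=> mf mg f0 fg; apply: ge0_le_integral => //.
- by move=> x _; exact: poweR_ge0.
- exact: measurable_slice_integrand.
- exact: measurable_slice_integrand.
- by move=> x _; apply: le_poweR => //; exact: ltW.
Qed.

Lemma energy_le f g : measurable_fun setT f -> measurable_fun setT g ->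
  (forall z, 0 <= f z)%E -> (forall z, slab T z -> f z <= g z)%E ->
  (energy f <= energy g)%E.
Proof.
move=> mf mg f0 fg; apply: ge0_le_integral => //.
- by move=> t _; rewrite mule_ge0 ?poweR_ge0// lee_fin powR_ge0.
- by apply: measurable_funTS; exact: measurable_energy_integrand.
- by apply: measurable_funTS; exact: measurable_energy_integrand.
- move=> t /=; rewrite in_itv/= => tT; rewrite lee_wpmul2r ?lee_fin ?powR_ge0//.
  apply: le_poweR; [exact: ltW|exact: slice_mass_ge0|].
  by apply: slice_mass_le => // x; exact: fg.
Qed.

Lemma energy_scale (c : R) f : 0 <= c -> measurable_fun setT f -> (forall z, 0 <= f z)%E ->
  energy (fun z => c%:E * f z)%E = ((c `^ q)%:E * energy f)%E.
Proof.
move=> c0 mf f0.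
have mE : measurable_fun `]0%R, T[ (fun t : measurableTypeR R =>
    slice_mass p f t `^ (q / p) * (t `^ k)%:E)%E.
  by apply: measurable_funTS; exact: measurable_energy_integrand.
rewrite -ge0_integralZl//; last 2 first.
- by move=> t _; rewrite mule_ge0 ?poweR_ge0// lee_fin powR_ge0.
- by rewrite lee_fin powR_ge0.
apply: eq_integral => t _; rewrite muleA; congr (_ * _)%E.
rewrite /slice_mass; under eq_integral do rewrite poweRM ?lee_fin// poweR_EFin.
rewrite ge0_integralZl//; last 3 first.
- exact: measurable_slice_integrand.
- by move=> x _; exact: poweR_ge0.
- by rewrite lee_fin powR_ge0.
rewrite poweRM ?lee_fin ?powR_ge0//; last exact: slice_mass_ge0.
by rewrite poweR_EFin -powRrM mulrCA divff ?mulr1// gt_eqF.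
Qed.

(** The constant of the triangle inequality up to a factor in [energy_add_le]: (2^p)^(q/p) = 2^q
    comes from the inner power p, and 2^(q/p) from the outer power q/p. *)
Definition quasi_const : R := 2 `^ q * 2 `^ (q / p).

Lemma energy_add_le f g : measurable_fun setT f -> measurable_fun setT g ->
  (forall z, 0 <= f z)%E -> (forall z, 0 <= g z)%E ->
  (energy (fun z => f z + g z) <= quasi_const%:E * (energy f + energy g))%E.
Proof.
move=> mf mg f0 g0.
have mfg : measurable_fun setT (fun z => f z + g z)%E by exact: emeasurable_funD.
have I0 (h : spacetime -> \bar R) (t : R) :
    (0 <= slice_mass p h t `^ (q / p) * (t `^ k)%:E)%E.
  by rewrite mule_ge0 ?poweR_ge0// lee_fin powR_ge0.
have mI (h : spacetime -> \bar R) : measurable_fun setT h ->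
    measurable_fun `]0%R, T[ (fun t : measurableTypeR R =>
      slice_mass p h t `^ (q / p) * (t `^ k)%:E)%E.
  by move=> mh; apply: measurable_funTS; exact: measurable_energy_integrand.
rewrite -ge0_integralD//; [|exact: mI|exact: mI].
rewrite -ge0_integralZl//; last 3 first.
- by apply: emeasurable_funD; exact: mI.
- by move=> t _; rewrite adde_ge0.
- by rewrite lee_fin mulr_ge0 ?powR_ge0.
apply: ge0_le_integral => //.
- exact: mI.
- apply: emeasurable_funM; first exact: measurable_cst.
  by apply: emeasurable_funD; exact: mI.
move=> t _; rewrite -ge0_muleDl ?poweR_ge0// muleA lee_wpmul2r ?lee_fin ?powR_ge0//.
have sle : (slice_mass p (fun z => f z + g z) t <=
    (2 `^ p)%:E * (slice_mass p f t + slice_mass p g t))%E.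
  rewrite -ge0_integralD//; last 4 first.
  - by move=> x _; exact: poweR_ge0.
  - exact: measurable_slice_integrand.
  - by move=> x _; exact: poweR_ge0.
  - exact: measurable_slice_integrand.
  rewrite -ge0_integralZl//; last 2 first.
  - by apply: emeasurable_funD; exact: measurable_slice_integrand.
  - by move=> x _; rewrite adde_ge0 ?poweR_ge0.
  apply: ge0_le_integral => //.
  - by move=> x _; exact: poweR_ge0.
  - exact: measurable_slice_integrand mfg.
  - apply: emeasurable_funM; first exact: measurable_cst.
    by apply: emeasurable_funD; exact: measurable_slice_integrand.
  - by move=> x _; exact: poweR_add_le.
have sf : (0 <= slice_mass p f t)%E by exact: slice_mass_ge0.
have sg : (0 <= slice_mass p g t)%E by exact: slice_mass_ge0.
have sfg : (0 <= slice_mass p (fun z => f z + g z) t)%E by exact: slice_mass_ge0.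
apply: (le_trans (le_poweR (ltW qp0) sfg sle)).
rewrite (@poweRM _ (2 `^ p)%:E) ?(adde_ge0 sf sg) ?lee_fin ?powR_ge0//.
rewrite poweR_EFin -powRrM mulrCA divff ?gt_eqF// mulr1 /quasi_const EFinM -muleA.
rewrite lee_wpmul2l ?lee_fin ?powR_ge0//.
exact: poweR_add_le qp0 sf sg.
Qed.

(** As t^k > 0 on the slab, almost every slice has mass 0; by Tonelli the integral of f^p over the
    slab is then 0 for the product measure. *)
Lemma energy_eq0 f : measurable_fun setT f -> (forall z, 0 <= f z)%E ->
  energy f = 0%E -> {ae (lebn \x leb)%E, forall z, slab T z -> f z = 0%E}.
Proof.
move=> mf f0 Ef.
pose fT := f \_ (slab T).
have mfT : measurable_fun setT fT.
  apply: (proj1 (measurable_restrictT _ measurable_slab)).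
  exact: measurable_funTS.
have fT0 z : (0 <= fT z)%E by rewrite /fT /patch; case: ifPn.
have mfp : measurable_fun setT (fun z => fT z `^ p)%E.
  exact: measurableT_comp (@measurable_poweR _ _) mfT.
have If0 : (\int[(lebn \x leb)%E]_z (fT z `^ p) = 0)%E.
  rewrite (@fubini_tonelli2 _ _ _ _ _ lebn leb (fun z => fT z `^ p)%E)//;
    last by move=> z; exact: poweR_ge0.
  rewrite -[RHS](integral0 leb setT).
  apply: ge0_ae_eq_integral => //.
  - apply: (@measurable_fun_fubini_tonelli_G _ _ _ _ R lebn (fun z => fT z `^ p)%E) => //.
    by move=> z; exact: poweR_ge0.
  - by move=> t _; apply: integral_ge0 => x _; exact: poweR_ge0.
  have mI := measurable_energy_integrand mf.
  have I0 (t : measurableTypeR R) : (0 <= slice_mass p f t `^ (q / p) * (t `^ k)%:E)%E.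
    by rewrite mule_ge0 ?poweR_ge0// lee_fin powR_ge0.
  have H := @ge0_integral_eq0_ae _ _ _ leb _ _ (measurable_itv `]0%R, T[) (measurable_funTS mI) I0 Ef.
  apply: filterS H => t tT _; rewrite /fubini_G; have [tI|tI] := boolP (t \in `]0%R, T[); last first.
    under eq_integral => x _.
      rewrite /fT /patch ifF ?poweR0r ?gt_eqF//; first by over.
      by apply: memNset; move: tI; rewrite /slab/= in_itv/= => /negP.
    by rewrite integral0.
  have t0 : 0 < t by move: tI; rewrite in_itv/= => /andP[].
  have /eqP := tT tI; rewrite mule_eq0 => /orP[/eqP|];
    last by rewrite eqe gt_eqF// powR_gt0.
  move=> /(poweR_eq0_eq0 (slice_mass_ge0 _ _ _)) <-.
  apply: eq_integral => x _; rewrite /fT /patch ifT// mem_set//.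
have := @ge0_integral_eq0_ae _ _ _ _ setT _ measurableT mfp (fun z => poweR_ge0 _ _) If0.
apply: filterS => z /(_ I) fz sz.
have : fT z = 0%E by exact: poweR_eq0_eq0 fz.
by rewrite /fT /patch mem_set.
Qed.

(** Chebyshev's argument: f is at least m times the indicator [X] of the set where it is infinite,
    so m^q times the energy of [X] is bounded in m, and that energy is 0. *)
Lemma energy_lty_ae f : measurable_fun setT f -> (forall z, 0 <= f z)%E ->
  (energy f < +oo)%E ->
  {ae (lebn \x leb)%E, forall z, slab T z -> (f z < +oo)%E}.
Proof.
move=> mf f0 Ef.
pose S := f @^-1` [set +oo%E].
have mS : measurable S.
  by rewrite -[S]setTI; apply: mf => //; exact: emeasurable_set1.
pose X (z : spacetime) : \bar R := (\1_S z)%:E.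
have mX : measurable_fun setT X by apply/measurable_EFinP; exact: measurable_indic.
have X0 z : (0 <= X z)%E by rewrite lee_fin.
have Xf (m : nat) : ((m%:R `^ q)%:E * energy X <= energy f)%E.
  rewrite -(energy_scale (ler0n R m) mX X0); apply: energy_le => //.
  - by apply: emeasurable_funM => //; exact: measurable_cst.
  - by move=> z; rewrite mule_ge0// lee_fin.
  - move=> z _; rewrite /X indicE; have [zS|zS] := boolP (z \in S).
      by move: zS; rewrite inE /S/= => ->; rewrite leey.
    by rewrite mule0.
have EX0 : energy X = 0%E.
  apply/eqP; rewrite eq_le energy_ge0 andbT leNgt; apply/negP => EX.
  have finE (e : \bar R) : (0 <= e)%E -> (e < +oo)%E -> exists2 c : R, e = c%:E & 0 <= c.
    by case: e => [c| |]//; rewrite lee_fin => c0 _; exists c.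
  have EXy : (energy X < +oo)%E.
    by apply: le_lt_trans Ef; have := Xf 1%N; rewrite powR1 mul1e.
  have [y Ey y0] := finE _ (energy_ge0 f) Ef.
  have [x Ex _] := finE _ (energy_ge0 X) EXy.
  move: EX Xf; rewrite Ex Ey lte_fin => x0 H.
  (* An integer m > B satisfies m^q x > y, contradicting the bound m^q x <= y. *)
  pose B := (y / x + 1) `^ q^-1.
  have [m Bm] : exists m : nat, B < m%:R.
    by exists (Num.bound B); apply: archi_boundP; exact: powR_ge0.
  have := H m; rewrite -EFinM lee_fin leNgt => /negP; apply.
  rewrite -ltr_pdivrMr//; apply: (@lt_le_trans _ _ (B `^ q)).
    by rewrite /B -powRrM mulVf ?gt_eqF// powRr1 ?ltrDl// addr_ge0// divr_ge0// ltW.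
  by rewrite ge0_ler_powR ?nnegrE ?powR_ge0 ?(ltW q0)// ltW.
apply: filterS (energy_eq0 mX X0 EX0) => z H sz.
rewrite ltey; apply/negP => /eqP fz.
have := H sz; rewrite /X indicE mem_set//= => /eqP.
by rewrite eqe oner_eq0.
Qed.

(** Monotone convergence in space, then in time, with [poweR_limn_le] carrying the powers p and q/p
    through the limit. *)
Lemma energy_sup_le (f_ : nat -> spacetime -> \bar R) (B : \bar R) :
  (forall j, measurable_fun setT (f_ j)) -> (forall j z, 0 <= f_ j z)%E ->
  (forall z, nondecreasing_seq (f_ ^~ z)) -> (forall j, energy (f_ j) <= B)%E ->
  (energy (fun z => limn (f_ ^~ z)) <= B)%E.
Proof.
move=> mf f0 ndf fB.
have ndsm t : nondecreasing_seq (fun j => slice_mass p (f_ j) t).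
  by move=> i j ij; apply: slice_mass_le => // x; exact: ndf.
have mlim : measurable_fun setT (fun z => limn (f_ ^~ z)).
  apply: (@emeasurable_fun_cvg _ _ _ _ f_) => // z _.
  exact: ereal_nondecreasing_is_cvgn.
have lim0 z : (0 <= limn (f_ ^~ z))%E.
  by apply: lime_ge; [exact: ereal_nondecreasing_is_cvgn|exact: nearW].
have mpow (g : spacetime -> \bar R) t : measurable_fun setT g ->
    measurable_fun setT (fun x => g (x, t) `^ p)%E.
  exact: measurable_slice_integrand.
have sm t : (slice_mass p (fun z => limn (f_ ^~ z)) t <=
    limn (fun j => slice_mass p (f_ j) t))%E.
  rewrite /slice_mass -monotone_convergence//; last 3 first.
  - by move=> j; exact: mpow.
  - by move=> j x _; exact: poweR_ge0.
  - by move=> x _ i j ij; apply: le_poweR => //; [exact: ltW|exact: ndf].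
  apply: ge0_le_integral => //.
  - by move=> x _; exact: poweR_ge0.
  - exact: (mpow _ t mlim).
  - apply: (@emeasurable_fun_cvg _ _ _ _ (fun j x => f_ j (x, t) `^ p)%E).
      by move=> j; exact: mpow.
    move=> x _; apply: ereal_nondecreasing_is_cvgn => i j ij.
    by apply: le_poweR => //; [exact: ltW|exact: ndf].
  - move=> x _; have := @poweR_limn_le _ (fun j => f_ j (x, t)) p 1 p0 ltr01.
    rewrite mule1 (_ : (fun j => _ * 1%:E)%E = (fun j => f_ j (x, t) `^ p)%E).
      by apply => //; exact: ndf.
    by apply/funext => j; rewrite mule1.
have ndE t : nondecreasing_seq (fun j => slice_mass p (f_ j) t `^ (q / p) * (t `^ k)%:E)%E.
  move=> i j ij; rewrite lee_wpmul2r ?lee_fin ?powR_ge0//.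
  by apply: le_poweR; [exact: ltW|exact: slice_mass_ge0|exact: ndsm].
have mE j : measurable_fun `]0%R, T[ (fun t : measurableTypeR R =>
    slice_mass p (f_ j) t `^ (q / p) * (t `^ k)%:E)%E.
  by apply: measurable_funTS; exact: measurable_energy_integrand.
apply: (@le_trans _ _ (limn (fun j => energy (f_ j)))); last first.
  apply: lime_le; last by apply: nearW.
  apply: ereal_nondecreasing_is_cvgn => i j ij.
  by apply: energy_le => // z _; exact: ndf.
rewrite /energy -monotone_convergence//; last first.
  by move=> j t _; rewrite mule_ge0 ?poweR_ge0// lee_fin powR_ge0.
apply: ge0_le_integral => //.
- by move=> t _; rewrite mule_ge0 ?poweR_ge0// lee_fin powR_ge0.
- by apply: measurable_funTS; exact: measurable_energy_integrand.
- apply: (@emeasurable_fun_cvg _ _ _ _ (fun j (t : measurableTypeR R) =>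
    slice_mass p (f_ j) t `^ (q / p) * (t `^ k)%:E)%E) => // t _.
  exact: ereal_nondecreasing_is_cvgn.
- move=> t /=; rewrite in_itv/= => /andP[t0 _].
  apply: le_trans (@poweR_limn_le _ (fun j => slice_mass p (f_ j) t) _ _ qp0 (powR_gt0 k t0) _ _).
  + rewrite lee_wpmul2r ?lee_fin ?powR_ge0//.
    by apply: le_poweR; [exact: ltW|exact: slice_mass_ge0|exact: sm].
  + by move=> j; exact: slice_mass_ge0.
  + exact: ndsm.
Qed.

Lemma mixed_normE (u : spacetime -> \bar R) :
  mixed_norm p q k T u = (energy (fun z => `|u z|) `^ q^-1)%E.
Proof.
rewrite /mixed_norm; congr (_ `^ _)%E; apply: eq_integral => t _.
congr (_ * _)%E; rewrite unlock /=.
by rewrite -poweRrM mulrC.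
Qed.

End energy_theory.

(** * The nonlinearity and its Lipschitz bound *)

Section signed_power.
Context {R : realType}.
Implicit Types (x y alpha : R).

Definition signed_pow alpha x : R := `|x| `^ (alpha - 1) * x.

Lemma powRS_sub1 alpha x : 1 < alpha -> 0 <= x -> x `^ (alpha - 1) * x = x `^ alpha.
Proof.
move=> alpha1 x0; rewrite -{2}(powRr1 x0) -powRD ?subrK//.
by rewrite gt_eqF// (lt_trans _ alpha1).
Qed.

Lemma signed_powN alpha x : signed_pow alpha (- x) = - signed_pow alpha x.
Proof. by rewrite /signed_pow normrN mulrN. Qed.

Lemma normr_signed_pow alpha x : 1 < alpha -> `|signed_pow alpha x| = `|x| `^ alpha.
Proof. by move=> a1; rewrite normrM [X in X * _]ger0_norm ?powR_ge0// powRS_sub1. Qed.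

Lemma ge0_signed_pow alpha x : 1 < alpha -> 0 <= x -> signed_pow alpha x = x `^ alpha.
Proof. by move=> a1 x0; rewrite /signed_pow ger0_norm// powRS_sub1. Qed.

Lemma signed_pow_le alpha : 1 < alpha -> {homo signed_pow alpha : x y / x <= y}.
Proof.
move=> a1 x y xy; have a0 : 0 <= alpha by rewrite ltW// (lt_trans _ a1).
have [x0|x0] := leP 0 x.
  rewrite !ge0_signed_pow// ?(le_trans x0)// ge0_ler_powR// nnegrE//.
  exact: le_trans xy.
have [y0|y0] := leP 0 y.
  apply: (@le_trans _ _ 0); last by rewrite mulr_ge0 ?powR_ge0.
  by rewrite mulr_ge0_le0 ?powR_ge0// ltW.
rewrite -[x]opprK -[y]opprK !(signed_powN _ (- _)) lerN2.
by rewrite !ge0_signed_pow ?oppr_ge0 ?(ltW x0) ?(ltW y0)// ge0_ler_powR ?nnegrE ?oppr_ge0 ?(ltW x0) ?(ltW y0)// lerN2.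
Qed.

(** With r = y/x in ]0, 1] and an integer m >= alpha, r^alpha >= r^m, and Bernoulli's inequality
    gives 1 - r^m <= m(1 - r). Hence the constant is a bound m of alpha rather than alpha itself. *)
Let pow_lip alpha x y : 1 < alpha -> 0 <= y <= x ->
  x `^ alpha - y `^ alpha <= (Num.bound alpha)%:R * (x `^ (alpha - 1) * (x - y)).
Proof.
move=> a1 /andP[y0 yx]; set m := Num.bound alpha.
have a0 : 0 < alpha by exact: lt_trans a1.
have am : alpha <= m%:R by rewrite ltW// archi_boundP// ltW.
have [x0|x0] := leP x 0.
  have x_0 : x = 0 by apply/eqP; rewrite eq_le x0 (le_trans y0).
  have y_0 : y = 0 by apply/eqP; rewrite eq_le y0 -x_0 yx.
  by rewrite x_0 y_0 !subrr !mulr0.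
have [y_0|yN0] := eqVneq y 0.
  rewrite y_0 powR0 ?gt_eqF// !subr0 powRS_sub1 ?(ltW x0)// ler_peMl ?powR_ge0//.
  by rewrite (le_trans (ltW a1)).
have yp : 0 < y by rewrite lt0r yN0.
pose r := y / x.
have r0 : 0 < r by rewrite divr_gt0.
have r1 : r <= 1 by rewrite ler_pdivrMr// mul1r.
have yE : y = x * r by rewrite mulrC divfK// gt_eqF.
have rm : r `^ m%:R <= r `^ alpha by rewrite ger_powR// r0 r1.
have bern (j : nat) : 1 - r ^+ j <= j%:R * (1 - r).
  elim: j => [|j IH]; first by rewrite expr0 subrr mul0r.
  rewrite exprS -natr1 mulrDl mul1r.
  apply: (@le_trans _ _ (r * (1 - r ^+ j) + (1 - r))); first by lra.
  rewrite lerD2r; apply: le_trans IH; apply: ler_piMl => //.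
  by rewrite subr_ge0; apply: exprn_ile1 => //; exact: ltW.
have key : 1 - r `^ alpha <= m%:R * (1 - r).
  by apply: le_trans (bern m); rewrite lerD2l lerN2 -powR_mulrn// ltW.
rewrite yE powRM ?(ltW x0) ?(ltW r0)//.
have -> : x `^ alpha - x `^ alpha * r `^ alpha = x `^ alpha * (1 - r `^ alpha) by ring.
have -> : x - x * r = x * (1 - r) by ring.
rewrite (mulrA (x `^ _)) powRS_sub1 ?(ltW x0)//.
by rewrite mulrCA ler_wpM2l ?powR_ge0.
Qed.

(** By symmetry and oddness one may take |b| <= a. If b >= 0 this is [pow_lip]; if b < 0, then
    a^alpha + |b|^alpha <= a^(alpha-1)(a + |b|). *)
Lemma signed_pow_lip alpha x y : 1 < alpha ->
  `|signed_pow alpha x - signed_pow alpha y| <=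
  (Num.bound alpha)%:R * ((`|x| + `|y|) `^ (alpha - 1) * `|x - y|).
Proof.
move=> a1; set m := Num.bound alpha.
have a0 : 0 < alpha by exact: lt_trans a1.
have am : alpha <= m%:R by rewrite ltW// archi_boundP// ltW.
have a10 : 0 <= alpha - 1 by rewrite subr_ge0 ltW.
suff H a b : `|b| <= `|a| -> 0 <= a ->
    `|signed_pow alpha a - signed_pow alpha b| <= m%:R * (`|a| `^ (alpha - 1) * `|a - b|).
  have H' a b : `|b| <= `|a| ->
      `|signed_pow alpha a - signed_pow alpha b| <= m%:R * (`|a| `^ (alpha - 1) * `|a - b|).
    move=> ba; have [a_ge|a_lt] := leP 0 a; first exact: H.
    have := H (- a) (- b); rewrite !normrN !signed_powN -!opprD !normrN; apply => //.
    by rewrite oppr_ge0 ltW.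
  have [xy|yx] := leP `|x| `|y|.
    rewrite distrC (distrC x); apply: (le_trans (H' _ _ xy)).
    apply: ler_wpM2l => //; apply: ler_wpM2r => //.
    by apply: ge0_ler_powR => //; rewrite ?nnegrE ?addr_ge0 ?lerDr.
  apply: (le_trans (H' _ _ (ltW yx))).
  apply: ler_wpM2l => //; apply: ler_wpM2r => //.
  by apply: ge0_ler_powR => //; rewrite ?nnegrE ?addr_ge0 ?lerDl.
move=> ba a_ge; rewrite (ger0_norm a_ge) in ba *.
have [b_ge|b_lt] := leP 0 b.
  rewrite (ger0_norm b_ge) in ba.
  rewrite ger0_norm ?subr_ge0 ?signed_pow_le// (ger0_norm (_ : 0 <= a - b)) ?subr_ge0//.
  by rewrite !ge0_signed_pow//; apply: pow_lip; rewrite ?b_ge.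
rewrite (ltr0_norm b_lt) in ba.
have nb : 0 <= - b by rewrite oppr_ge0 ltW.
rewrite -[in signed_pow alpha b](opprK b) signed_powN opprK.
rewrite !ge0_signed_pow// [X in X <= _]ger0_norm ?addr_ge0 ?powR_ge0//.
rewrite (@ger0_norm _ (a - b)) ?addr_ge0//.
apply: (@le_trans _ _ (a `^ (alpha - 1) * (a - b))); last first.
  rewrite ler_peMl ?mulr_ge0 ?powR_ge0 ?addr_ge0//.
  by rewrite (le_trans (ltW a1)).
rewrite mulrDr powRS_sub1// lerD2l -(powRS_sub1 a1 nb) ler_wpM2r//.
by rewrite ge0_ler_powR ?nnegrE.
Qed.

Lemma measurable_signed_pow alpha : measurable_fun setT (signed_pow alpha).
Proof.
apply: measurable_funM => //.
by apply: measurableT_comp (@measurable_powR _ _) _; exact: normr_measurable.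
Qed.

End signed_power.

(** * Order, linearity and limits for the Duhamel operator *)

Section duhamel_theory.
Context {R : realType} {n : nat}.
Local Notation leb := (@lebesgue_measure R).
Local Notation lebn := (@lebesgueRn R n).
Local Notation spacetime := (Rn R n * measurableTypeR R)%type.
Implicit Types f g : spacetime -> \bar R.
Local Open Scope ereal_scope.

Lemma duhamel_le f g z : measurable_fun setT f -> measurable_fun setT g ->
  (forall z, 0 <= f z) -> (forall z, 0 <= g z) ->
  (forall y (s : R), (0 < s < z.2)%R -> f (y, s) <= g (y, s)) ->
  duhamel f z <= duhamel g z.
Proof.
move=> mf mg f0 g0 fg; apply: ge0_le_integral => //.
- by move=> s _; exact: heat_avg_ge0.
- by apply: measurable_funTS; exact: measurable_heat_avg_time.
- by apply: measurable_funTS; exact: measurable_heat_avg_time.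
- move=> s /=; rewrite in_itv/= => sz; apply: ge0_le_integral => //.
  + by move=> y _; rewrite mule_ge0// lee_fin heat_kernel_ge0.
  + exact: measurable_heat_avg_integrand.
  + exact: measurable_heat_avg_integrand.
  + by move=> y _; rewrite lee_wpmul2l ?lee_fin ?heat_kernel_ge0// fg.
Qed.

Lemma duhamelD f g z : measurable_fun setT f -> measurable_fun setT g ->
  (forall z, 0 <= f z) -> (forall z, 0 <= g z) ->
  duhamel (fun z => f z + g z) z = duhamel f z + duhamel g z.
Proof.
move=> mf mg f0 g0; rewrite -ge0_integralD//; last 4 first.
- by move=> s _; exact: heat_avg_ge0.
- by apply: measurable_funTS; exact: measurable_heat_avg_time.
- by move=> s _; exact: heat_avg_ge0.
- by apply: measurable_funTS; exact: measurable_heat_avg_time.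
apply: eq_integral => s _; rewrite /heat_avg -ge0_integralD//; last 4 first.
- by move=> y _; rewrite mule_ge0// lee_fin heat_kernel_ge0.
- exact: measurable_heat_avg_integrand.
- by move=> y _; rewrite mule_ge0// lee_fin heat_kernel_ge0.
- exact: measurable_heat_avg_integrand.
by apply: eq_integral => y _; rewrite ge0_muleDr.
Qed.

Lemma duhamelZ (c : R) f z : (0 <= c)%R -> measurable_fun setT f ->
  (forall z, 0 <= f z) -> duhamel (fun z => c%:E * f z) z = c%:E * duhamel f z.
Proof.
move=> c0 mf f0; rewrite -ge0_integralZl//; last 2 first.
- by apply: measurable_funTS; exact: measurable_heat_avg_time.
- by move=> s _; exact: heat_avg_ge0.
apply: eq_integral => s _; rewrite /heat_avg -ge0_integralZl//; last 2 first.
- exact: measurable_heat_avg_integrand.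
- by move=> y _; rewrite mule_ge0// lee_fin heat_kernel_ge0.
by apply: eq_integral => y _; rewrite muleCA.
Qed.

Lemma duhamel_lim (f_ : nat -> spacetime -> \bar R) z :
  (forall j, measurable_fun setT (f_ j)) -> (forall j z, 0 <= f_ j z) ->
  (forall z, nondecreasing_seq (f_ ^~ z)) ->
  duhamel (fun z => limn (f_ ^~ z)) z = limn (fun j => duhamel (f_ j) z).
Proof.
move=> mf f0 ndf; rewrite /duhamel -monotone_convergence//; last 3 first.
- by move=> j; apply: measurable_funTS; exact: measurable_heat_avg_time.
- by move=> j s _; exact: heat_avg_ge0.
- move=> s _ i j ij; apply: ge0_le_integral => //.
  + by move=> y _; rewrite mule_ge0// lee_fin heat_kernel_ge0.
  + exact: measurable_heat_avg_integrand.
  + exact: measurable_heat_avg_integrand.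
  + by move=> y _; rewrite lee_wpmul2l ?lee_fin ?heat_kernel_ge0// ndf.
apply: eq_integral => s _; rewrite /heat_avg -monotone_convergence//; last 3 first.
- by move=> j; exact: measurable_heat_avg_integrand.
- by move=> j y _; rewrite mule_ge0// lee_fin heat_kernel_ge0.
- by move=> y _ i j ij; rewrite lee_wpmul2l ?lee_fin ?heat_kernel_ge0// ndf.
apply: eq_integral => y _; rewrite limeMl//.
by apply: ereal_nondecreasing_is_cvgn; exact: ndf.
Qed.

(** The integral of F is defined through its positive and negative parts, not through A and B. These
    parts lie below A and B, so their Duhamel integrals are finite at z and may be subtracted. *)
Lemma duhamel_sub (F A B : spacetime -> R) z :
  measurable_fun setT A -> measurable_fun setT B ->
  (forall z, 0 <= A z)%R -> (forall z, 0 <= B z)%R ->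
  (forall z, F z = A z - B z)%R ->
  duhamel (EFin \o A) z < +oo -> duhamel (EFin \o B) z < +oo ->
  \int[leb]_(s in `]0%R, (z.2 : R)[) \int[lebn]_y
    (heat_kernel ((z.2 : R) - s) (subRn z.1 y) * F (y, s))%:E =
  duhamel (EFin \o A) z - duhamel (EFin \o B) z.
Proof.
move=> mA mB A0 B0 FE finA finB.
pose Fp z : \bar R := (Num.max (F z) 0%R)%:E.
pose Fn z : \bar R := (Num.max (- F z) 0%R)%:E.
have mF : measurable_fun setT F.
  have -> : F = (A \- B)%R by exact/funext.
  exact: measurable_funB.
have mFp : measurable_fun setT Fp.
  by apply/measurable_EFinP; apply: measurable_maxr => //; exact: measurable_cst.
have mFn : measurable_fun setT Fn.
  apply/measurable_EFinP; apply: measurable_maxr; last exact: measurable_cst.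
  exact: measurable_funN.
have Fp0 z' : 0 <= Fp z' by rewrite lee_fin le_max lexx orbT.
have Fn0 z' : 0 <= Fn z' by rewrite lee_fin le_max lexx orbT.
have mEA : measurable_fun setT (EFin \o A) by exact/measurable_EFinP.
have mEB : measurable_fun setT (EFin \o B) by exact/measurable_EFinP.
have finFp : duhamel Fp z < +oo.
  apply: le_lt_trans finA; apply: duhamel_le => // y s _; rewrite lee_fin.
  by rewrite ge_max A0 andbT FE gerBl.
have finFn : duhamel Fn z < +oo.
  apply: le_lt_trans finB; apply: duhamel_le => // y s _; rewrite lee_fin.
  by rewrite ge_max B0 andbT FE opprB gerBl.
have inner s : \int[lebn]_y (heat_kernel ((z.2 : R) - s) (subRn z.1 y) * F (y, s))%:E =
    heat_avg Fp z s - heat_avg Fn z s.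
  rewrite integralE; congr (_ - _); apply: eq_integral => y _.
    rewrite funeposE /Fp -EFin_max -EFinM; congr (_%:E).
    by rewrite maxr_pMr ?heat_kernel_ge0// mulr0.
  rewrite funenegE /Fn -EFinN -EFin_max -EFinM; congr (_%:E).
  by rewrite maxr_pMr ?heat_kernel_ge0// mulr0 mulrN.
under eq_integral do rewrite inner.
have intg (G : spacetime -> \bar R) : measurable_fun setT G -> (forall z, 0 <= G z) ->
    duhamel G z < +oo -> leb.-integrable `]0%R, (z.2 : R)[ (heat_avg G z).
  move=> mG G0 finG; apply/integrableP; split.
    by apply: measurable_funTS; exact: measurable_heat_avg_time.
  under eq_integral => s _ do rewrite gee0_abs ?heat_avg_ge0//.
  exact: finG.
rewrite integralB; [|exact: measurable_itv|exact: intg mFp Fp0 finFp|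
  exact: intg mFn Fn0 finFn].
rewrite -/(duhamel Fp z) -/(duhamel Fn z).
have EA0 z' : 0 <= (EFin \o A) z' by rewrite lee_fin.
have EB0 z' : 0 <= (EFin \o B) z' by rewrite lee_fin.
(* From F+ + B = F- + A, additivity passes from the pair (F+, F-) to (A, B). *)
have : duhamel Fp z + duhamel (EFin \o B) z = duhamel Fn z + duhamel (EFin \o A) z.
  rewrite -(duhamelD _ mFp mEB Fp0 EB0) -(duhamelD _ mFn mEA Fn0 EA0).
  congr (duhamel _ z); apply/funext => z'; rewrite /= -!EFinD; congr (_%:E).
  by rewrite FE; case: (leP (A z' - B z')%R 0%R); case: (leP (- (A z' - B z'))%R 0%R); lra.
have fnum (x : \bar R) : 0 <= x -> x < +oo -> exists a, x = a%:E.
  by move=> x0 xoo; exists (fine x); rewrite fineK// ge0_fin_numE.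
have [a ->] := fnum _ (duhamel_ge0 Fp0 z) finFp.
have [b ->] := fnum _ (duhamel_ge0 Fn0 z) finFn.
have [c ->] := fnum _ (duhamel_ge0 EA0 z) finA.
have [d ->] := fnum _ (duhamel_ge0 EB0 z) finB.
by move=> [H]; rewrite -!EFinB; congr (_%:E); lra.
Qed.

End duhamel_theory.

(** * Energy and almost everywhere statements *)

Section almost_everywhere.
Context {R : realType} {n : nat}.
Local Notation leb := (@lebesgue_measure R).
Local Notation lebn := (@lebesgueRn R n).
Local Notation spacetime := (Rn R n * measurableTypeR R)%type.
Variables p q k T : R.
Hypotheses (p0 : 0 < p) (q0 : 0 < q).
Implicit Types f g : spacetime -> \bar R.
Local Notation energy := (energy p q k T).

Lemma eq_energy f g : (forall z, slab T z -> f z = g z) -> energy f = energy g.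
Proof.
move=> fg; apply: eq_integral => t; rewrite inE/= in_itv/= => tT.
congr (_ `^ _ * _)%E; apply: eq_integral => x _.
by rewrite fg.
Qed.

Lemma energy_ae0 f : measurable_fun setT f -> (forall z, 0 <= f z)%E ->
  {ae (lebn \x leb)%E, forall z, slab T z -> f z = 0%E} -> energy f = 0%E.
Proof.
move=> mf f0 fae.
pose fT := f \_ (slab T).
have mfT : measurable_fun setT fT.
  apply: (proj1 (measurable_restrictT _ (measurable_slab _))).
  exact: measurable_funTS.
have fT0 z : (0 <= fT z)%E by rewrite /fT /patch; case: ifPn.
have mfp : measurable_fun setT (fun z => fT z `^ p)%E.
  exact: measurableT_comp (@measurable_poweR _ _) mfT.
have If0 : (\int[(lebn \x leb)%E]_z (fT z `^ p) = 0)%E.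
  rewrite -[RHS](integral0 (lebn \x leb)%E setT).
  apply: ge0_ae_eq_integral => //; first by move=> z _; exact: poweR_ge0.
  apply: filterS fae => z H _; rewrite /fT /patch; case: ifPn => [/set_mem zT|_].
    by rewrite H// poweR0r// gt_eqF.
  by rewrite poweR0r// gt_eqF.
have fTp0 z : (0 <= fT z `^ p)%E by exact: poweR_ge0.
rewrite (@fubini_tonelli2 _ _ _ _ _ lebn leb (fun z => fT z `^ p)%E mfp fTp0) in If0.
have G0 (t : measurableTypeR R) : (0 <= fubini_G lebn (fun z => fT z `^ p) t)%E.
  by apply: integral_ge0 => x _; exact: poweR_ge0.
have H := @ge0_integral_eq0_ae _ _ _ leb _ _ measurableT
  (@measurable_fun_fubini_tonelli_G _ _ _ _ R lebn _ mfp fTp0) G0 If0.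
rewrite /energy -[RHS](integral0 leb `]0%R, T[).
apply: ge0_ae_eq_integral => //.
- by apply: measurable_funTS; exact: measurable_energy_integrand.
- by move=> t _; rewrite mule_ge0 ?poweR_ge0// lee_fin powR_ge0.
apply: filterS H => t /(_ I) H; rewrite /= in_itv/= => tT.
have -> : slice_mass p f t = 0%E.
  rewrite -[RHS]H; apply: eq_integral => x _.
  by rewrite /fT /patch ifT// mem_set.
by rewrite poweR0r ?mul0e// gt_eqF// divr_gt0.
Qed.

(** Pointwise w <= g + d, where d, the positive part of w - g, vanishes almost everywhere and so has
    energy 0. The price is one factor [quasi_const]. *)
Lemma energy_le_ae (w : spacetime -> R) g : measurable_fun setT w -> measurable_fun setT g ->
  (forall z, 0 <= w z) -> (forall z, 0 <= g z)%E ->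
  {ae (lebn \x leb)%E, forall z, slab T z -> ((w z)%:E <= g z)%E} ->
  (energy (EFin \o w) <= (quasi_const p q)%:E * energy g)%E.
Proof.
move=> mw mg w0 g0 wg.
pose d z : \bar R := Order.max ((w z)%:E - g z)%E 0%E.
have mEw : measurable_fun setT (EFin \o w) by exact/measurable_EFinP.
have md : measurable_fun setT d.
  apply: measurable_maxe; last exact: measurable_cst.
  exact: emeasurable_funB.
have d0 z : (0 <= d z)%E by rewrite /d le_max lexx orbT.
have Ed : energy d = 0%E.
  apply: energy_ae0 => //; apply: filterS wg => z H /H wz.
  by apply/max_idPr; rewrite sube_le0.
apply: (@le_trans _ _ (energy (fun z => g z + d z)%E)); last first.
  have := energy_add_le k T p0 q0 mg md g0 d0; rewrite Ed adde0.
  exact: le_trans.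
apply: energy_le => //.
- exact: emeasurable_funD.
- move=> z _ /=; have := g0 z; rewrite /d; case: (g z) => [r| |]//= r0.
    by rewrite -EFinB -EFin_max -EFinD lee_fin; case: (leP (w z - r) 0); lra.
  by rewrite addye ?leey// -ltNye (lt_le_trans (ltNyr 0%R))// le_max lexx orbT.
Qed.

End almost_everywhere.

(** * The mild equation for real-valued functions *)

Section mild_solutions.
Context {R : realType} {n : nat}.
Local Notation leb := (@lebesgue_measure R).
Local Notation lebn := (@lebesgueRn R n).
Local Notation spacetime := (Rn R n * measurableTypeR R)%type.
Variables (alpha : R) (U : Rn R n -> R).
Hypothesis alpha1 : 1 < alpha.

(** At a point of the slab only earlier times enter, so a solution may be replaced by its extension
    by 0, which is measurable everywhere. *)
Lemma eq_mild_map (u v : spacetime -> R) T z : slab T z ->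
  (forall z', slab T z' -> u z' = v z') -> mild_map alpha U u z = mild_map alpha U v z.
Proof.
move=> /andP[z0 zT] uv; congr (_ + _)%E; apply: eq_integral => s.
rewrite inE/= in_itv/= => /andP[s0 sz]; apply: eq_integral => y _.
by rewrite uv// /slab/= s0 (lt_trans sz).
Qed.

Definition pos_source (u : spacetime -> R) z : R := Num.max (signed_pow alpha (u z)) 0.
Definition neg_source (u : spacetime -> R) z : R := Num.max (- signed_pow alpha (u z)) 0.

Lemma pos_source_ge0 u z : 0 <= pos_source u z.
Proof. by rewrite le_max lexx orbT. Qed.

Lemma neg_source_ge0 u z : 0 <= neg_source u z.
Proof. by rewrite le_max lexx orbT. Qed.

Lemma signed_pow_source u z : signed_pow alpha (u z) = pos_source u z - neg_source u z.
Proof.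
rewrite /pos_source /neg_source; move: (signed_pow _ _) => x.
by case: (leP x 0); case: (leP (- x) 0); lra.
Qed.

Lemma measurable_pos_source u : measurable_fun setT u -> measurable_fun setT (pos_source u).
Proof.
move=> mu; apply: measurable_maxr; last exact: measurable_cst.
exact: measurableT_comp (measurable_signed_pow _) mu.
Qed.

Lemma measurable_neg_source u : measurable_fun setT u -> measurable_fun setT (neg_source u).
Proof.
move=> mu; apply: measurable_maxr; last exact: measurable_cst.
apply: measurable_funN; exact: measurableT_comp (measurable_signed_pow _) mu.
Qed.

Lemma measurable_normpow (u : spacetime -> R) (r : R) : measurable_fun setT u ->
  measurable_fun setT (fun z => (`|u z| `^ r)%:E).
Proof.
move=> mu; apply/measurable_EFinP; apply: measurableT_comp (@measurable_powR _ _) _.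
exact: measurableT_comp (@normr_measurable _ _) mu.
Qed.

Lemma duhamel_source_lty (u : spacetime -> R) z : measurable_fun setT u ->
  (duhamel (fun z : spacetime => (`|u z| `^ alpha)%:E) z < +oo)%E ->
  (duhamel (EFin \o pos_source u) z < +oo)%E /\
  (duhamel (EFin \o neg_source u) z < +oo)%E.
Proof.
move=> mu fin; have mp := measurable_normpow alpha mu.
have mP : measurable_fun setT (EFin \o pos_source u).
  by apply/measurable_EFinP; exact: measurable_pos_source.
have mN : measurable_fun setT (EFin \o neg_source u).
  by apply/measurable_EFinP; exact: measurable_neg_source.
have pw0 (z' : spacetime) : (0 <= (`|u z'| `^ alpha)%:E)%E by rewrite lee_fin powR_ge0.
have P0 z' : (0 <= (EFin \o pos_source u) z')%E by rewrite lee_fin pos_source_ge0.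
have N0 z' : (0 <= (EFin \o neg_source u) z')%E by rewrite lee_fin neg_source_ge0.
split; apply: le_lt_trans fin; apply: duhamel_le => // y s _;
  rewrite lee_fin -normr_signed_pow// ge_max normr_ge0 andbT.
  exact: ler_norm.
by rewrite -normrN ler_norm.
Qed.

Lemma mild_map_source (u : spacetime -> R) z : measurable_fun setT u ->
  (duhamel (fun z : spacetime => (`|u z| `^ alpha)%:E) z < +oo)%E ->
  mild_map alpha U u z = (heat_flow U z +
    (duhamel (EFin \o pos_source u) z - duhamel (EFin \o neg_source u) z))%E.
Proof.
move=> mu fin; have [finP finN] := duhamel_source_lty mu fin.
congr (_ + _)%E.
apply: (@duhamel_sub _ _ (fun z => signed_pow alpha (u z))) => //.
- exact: measurable_pos_source.
- exact: measurable_neg_source.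
- exact: pos_source_ge0.
- exact: neg_source_ge0.
- exact: signed_pow_source.
Qed.

(* Stated where both nonlinear terms are finite, that is, almost everywhere. *)
Lemma mild_difference_le (u v : spacetime -> R) (z : spacetime) :
  measurable_fun setT u -> measurable_fun setT v ->
  (duhamel (fun z : spacetime => (`|u z| `^ alpha)%:E) z < +oo)%E ->
  (duhamel (fun z : spacetime => (`|v z| `^ alpha)%:E) z < +oo)%E ->
  (u z)%:E = mild_map alpha U u z -> (v z)%:E = mild_map alpha U v z ->
  ((`|u z - v z|)%:E <=
    duhamel (fun z : spacetime => (`|signed_pow alpha (u z) - signed_pow alpha (v z)|)%:E) z)%E.
Proof.
move=> mu mv finu finv; rewrite mild_map_source// mild_map_source//.
have [Pu Nu] := duhamel_source_lty mu finu.
have [Pv Nv] := duhamel_source_lty mv finv.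
pose dif := fun z : spacetime => (`|signed_pow alpha (u z) - signed_pow alpha (v z)|)%:E.
rewrite -/dif.
have mdif : measurable_fun setT dif.
  apply/measurable_EFinP; apply: measurableT_comp (@normr_measurable _ _) _.
  apply: measurable_funB.
    exact: measurableT_comp (measurable_signed_pow _) mu.
  exact: measurableT_comp (measurable_signed_pow _) mv.
have mEP w : measurable_fun setT w -> measurable_fun setT (EFin \o pos_source w).
  by move=> mw; apply/measurable_EFinP; exact: measurable_pos_source.
have mEN w : measurable_fun setT w -> measurable_fun setT (EFin \o neg_source w).
  by move=> mw; apply/measurable_EFinP; exact: measurable_neg_source.
have P0 w z' : (0 <= (EFin \o pos_source w) z')%E by rewrite lee_fin pos_source_ge0.
have N0 w z' : (0 <= (EFin \o neg_source w) z')%E by rewrite lee_fin neg_source_ge0.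
have dif0 z' : (0 <= dif z')%E by rewrite lee_fin.
(* The bound is put in the form a+ + b- <= b+ + a- + |a - b| between nonnegative sources, so that
   [duhamel] preserves it with no subtraction of possibly infinite values. *)
have cmp (a b : spacetime -> R) : measurable_fun setT a -> measurable_fun setT b ->
    (forall z, (`|signed_pow alpha (a z) - signed_pow alpha (b z)|)%:E = dif z) ->
    (duhamel (EFin \o pos_source a) z + duhamel (EFin \o neg_source b) z <=
     duhamel (EFin \o pos_source b) z + duhamel (EFin \o neg_source a) z + duhamel dif z)%E.
  move=> ma mb abd.
  have mPa := mEP _ ma. have mPb := mEP _ mb. have mNa := mEN _ ma. have mNb := mEN _ mb.
  have mS : measurable_fun setT
      (fun z => (EFin \o pos_source b) z + (EFin \o neg_source a) z)%E.
    exact: emeasurable_funD.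
  have S0 z' : (0 <= (EFin \o pos_source b) z' + (EFin \o neg_source a) z')%E.
    by rewrite adde_ge0.
  rewrite -(duhamelD _ mPa mNb)// -(duhamelD _ mPb mNa)// -(duhamelD _ mS mdif)//.
  apply: duhamel_le => //.
  - exact: emeasurable_funD.
  - exact: emeasurable_funD.
  - by move=> z'; rewrite adde_ge0.
  - by move=> z'; rewrite adde_ge0.
  - move=> y s _; rewrite -abd /= -!EFinD lee_fin.
    rewrite !signed_pow_source.
    move: (pos_source a (y, s)) (neg_source a (y, s)) (pos_source b (y, s))
      (neg_source b (y, s)) => a1 a2 b1 b2.
    by have := ler_norm (a1 - a2 - (b1 - b2)); lra.
have /(_ (fun=> erefl)) c1 := cmp u v mu mv.
have /(_ (fun z => congr1 EFin (distrC _ _))) c2 := cmp v u mv mu.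
have [->|dfin] := eqVneq (duhamel dif z) +oo%E; first by rewrite leey.
have fnum (x : \bar R) : (0 <= x)%E -> (x < +oo)%E -> exists a, x = a%:E.
  by move=> x0 xoo; exists (fine x); rewrite fineK// ge0_fin_numE.
move: c1 c2.
have [a ->] := fnum _ (duhamel_ge0 (P0 u) z) Pu.
have [b ->] := fnum _ (duhamel_ge0 (N0 u) z) Nu.
have [c ->] := fnum _ (duhamel_ge0 (P0 v) z) Pv.
have [d ->] := fnum _ (duhamel_ge0 (N0 v) z) Nv.
have [|e ->] := fnum _ (duhamel_ge0 dif0 z); first by rewrite ltey.
rewrite -!EFinB -!EFinD !lee_fin => c1 c2.
(* Since u z is real, the mild equation excludes infinite values of the heat flow, and the common
   finite term cancels. *)
case: (heat_flow U z) => [h| |]//= [->] [->].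
by rewrite ler_norml; apply/andP; split; lra.
Qed.

End mild_solutions.

(** * Uniqueness and existence from the nonlinear estimate *)

Section fixed_point.
Context {R : realType} {n : nat}.
Local Notation leb := (@lebesgue_measure R).
Local Notation lebn := (@lebesgueRn R n).
Local Notation spacetime := (Rn R n * measurableTypeR R)%type.
Variables (alpha k p q C r : R) (U : Rn R n -> R).
Hypotheses (alpha1 : 1 < alpha) (p0 : 0 < p) (q0 : 0 < q) (C0 : 0 <= C) (r0 : 0 < r).
(** The estimate of [energy_duhamel_le], with its exponent abbreviated to r. Smallness will come
    from T^r alone. *)
Hypothesis contraction : forall T (f : spacetime -> \bar R), 0 < T ->
  measurable_fun setT f -> (forall z, 0 <= f z)%E ->
  (energy p q k T (duhamel (fun z => f z `^ alpha)) <=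
   (C * T `^ r)%:E * energy p q k T f `^ alpha)%E.

Let alpha0 : 0 < alpha. Proof. exact: lt_trans alpha1. Qed.
Local Notation K := (quasi_const p q).

Let K0 : 0 < K. Proof. by rewrite mulr_gt0 ?powR_gt0. Qed.

Lemma small_time (X T0 : R) : 0 <= X -> 0 < T0 ->
  exists T, [/\ 0 < T, T <= T0 & X * T `^ r < 1].
Proof.
(* This makes T^r at most 1/(X + 1). *)
move=> X0 T00; pose T := Num.min T0 ((X + 1) `^ (- r^-1)).
have X1 : 0 < X + 1 by rewrite ltr_wpDl.
have T_gt0 : 0 < T by rewrite lt_min T00 powR_gt0.
exists T; split => //; first by rewrite ge_min lexx.
apply: (@le_lt_trans _ _ (X * (X + 1)^-1)).
  rewrite ler_wpM2l//; apply: (@le_trans _ _ (((X + 1) `^ (- r^-1)) `^ r)).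
    by rewrite ge0_ler_powR ?nnegrE ?powR_ge0 ?(ltW r0) ?(ltW T_gt0)// ge_min lexx orbT.
  by rewrite -powRrM mulNr mulVf ?gt_eqF// powR_inv1// ltW.
by rewrite ltr_pdivrMr// mul1r ltrDl.
Qed.

Lemma measurable_fun_slab_ext (T : R) (u : spacetime -> R) :
  measurable_fun (slab T) (EFin \o u) ->
  exists2 v : spacetime -> R, measurable_fun setT v & forall z, slab T z -> u z = v z.
Proof.
move=> /measurable_EFinP mu; exists (u \_ (slab T)).
  exact: (proj1 (measurable_restrictT _ (measurable_slab _))).
by move=> z zT; rewrite /patch mem_set.
Qed.

Lemma duhamel_pow_lty_ae (T : R) (u : spacetime -> R) : 0 < T ->
  measurable_fun setT u -> (energy p q k T (fun z => (`|u z|)%:E) < +oo)%E ->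
  {ae (lebn \x leb)%E, forall z, slab T z ->
    (duhamel (fun z : spacetime => (`|u z| `^ alpha)%:E) z < +oo)%E}.
Proof.
move=> T0 mu Eu.
have mEu : measurable_fun setT (fun z : spacetime => (`|u z|)%:E).
  by apply/measurable_EFinP; exact: measurableT_comp (@normr_measurable _ _) mu.
have u0 z : (0 <= (`|u z|)%:E)%E by rewrite lee_fin.
have pw0 (z : spacetime) : (0 <= (`|u z| `^ alpha)%:E)%E by rewrite lee_fin powR_ge0.
apply: (@energy_lty_ae _ _ p q k) => //.
- by apply: measurable_duhamel => //; exact: measurable_normpow.
- by move=> z; exact: duhamel_ge0.
- apply: (le_lt_trans (contraction T0 mEu u0)).
  have [e ->] : exists e, energy p q k T (fun z => (`|u z|)%:E) = e%:E.
    by exists (fine (energy p q k T (fun z => (`|u z|)%:E)));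
      rewrite fineK// ge0_fin_numE// energy_ge0.
  by rewrite poweR_EFin -EFinM ltry.
Qed.

(** With V = |u| + |v| and w = |u - v|, the mixed source V^(alpha-1) w is brought under a single
    power of G = V + w/del, so that [contraction] applies to G; del is tuned to the energy e of w,
    and a short time makes e < e unless e = 0. *)
Lemma mild_solution_unique (A : R) : 0 < A -> exists2 T : R, 0 < T &
  forall u v : spacetime -> R,
  mild_solution alpha p q k T U u -> (mixed_norm p q k T (EFin \o u) <= A%:E)%E ->
  mild_solution alpha p q k T U v -> (mixed_norm p q k T (EFin \o v) <= A%:E)%E ->
  ae_eq_on T (EFin \o u) (EFin \o v).
Proof.
move=> A0; pose m : R := (Num.bound alpha)%:R.
have m0 : 0 <= m by [].
pose B := 2 * K * A `^ q + 1.
have B0 : 0 < B by rewrite ltr_wpDl// mulr_ge0 ?powR_ge0// mulr_ge0// ltW.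
(* X T^r is exactly the factor of e in the final inequality; B bounds the energy of V, because K(A^q
   + A^q) <= B. *)
pose X := K * m `^ q * C * (2 * K * B) `^ alpha / B.
have X0 : 0 <= X.
  by rewrite divr_ge0 ?(ltW B0)// !mulr_ge0 ?powR_ge0// ltW.
have [T [T0 _ XT]] := small_time X0 ltr01.
exists T => // u0 v0 [[mu0 _] eu0] nu0 [[mv0 _] ev0] nv0.
have [u mu u0E] := measurable_fun_slab_ext mu0.
have [v mv v0E] := measurable_fun_slab_ext mv0.
have normE (a0 a : spacetime -> R) : (forall z, slab T z -> a0 z = a z) ->
    (mixed_norm p q k T (EFin \o a0) <= A%:E)%E ->
    (energy p q k T (fun z => (`|a z|)%:E) <= (A `^ q)%:E)%E.
  move=> aE; rewrite mixed_normE => na.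
  have -> : energy p q k T (fun z => (`|a z|)%:E) =
      energy p q k T (fun z => `|(EFin \o a0) z|)%E.
    by apply: eq_energy => z zT /=; rewrite aE.
  have := le_poweR (ltW q0) (poweR_ge0 _ _) na.
  by rewrite -poweRrM mulVf ?gt_eqF// poweRe1 ?energy_ge0// poweR_EFin.
have Eu := normE _ _ u0E nu0; have Ev := normE _ _ v0E nv0.
pose V z := `|u z| + `|v z|; pose w z := `|u z - v z|.
have mnu : measurable_fun setT (fun z => `|u z|).
  exact: measurableT_comp (@normr_measurable _ _) mu.
have mnv : measurable_fun setT (fun z => `|v z|).
  exact: measurableT_comp (@normr_measurable _ _) mv.
have mV : measurable_fun setT V by exact: measurable_funD.
have mw : measurable_fun setT w.
  by apply: measurableT_comp (@normr_measurable _ _) _; exact: measurable_funB.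
have mEV : measurable_fun setT (EFin \o V) by exact/measurable_EFinP.
have mEw : measurable_fun setT (EFin \o w) by exact/measurable_EFinP.
have V0 z : 0 <= V z by rewrite addr_ge0.
have w0 z : 0 <= w z by rewrite /w.
have EVB : (energy p q k T (EFin \o V) <= B%:E)%E.
  have -> : EFin \o V = (fun z => (`|u z|)%:E + (`|v z|)%:E)%E by [].
  have mEu : measurable_fun setT (fun z => (`|u z|)%:E) by exact/measurable_EFinP.
  have mEv : measurable_fun setT (fun z => (`|v z|)%:E) by exact/measurable_EFinP.
  have u_ge0 z : (0 <= (`|u z|)%:E)%E by rewrite lee_fin.
  have v_ge0 z : (0 <= (`|v z|)%:E)%E by rewrite lee_fin.
  apply: (le_trans (energy_add_le k T p0 q0 mEu mEv u_ge0 v_ge0)).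
  apply: (@le_trans _ _ (K%:E * ((A `^ q)%:E + (A `^ q)%:E))%E).
    by apply: lee_wpmul2l (leeD Eu Ev); rewrite lee_fin ltW.
  by rewrite -EFinD -EFinM lee_fin /B; lra.
have EwB : (energy p q k T (EFin \o w) <= B%:E)%E.
  apply: le_trans EVB; apply: energy_le => // z _; rewrite lee_fin.
  exact: ler_normB.
have Ew0 : (0 <= energy p q k T (EFin \o w))%E by exact: energy_ge0.
suff Ew : energy p q k T (EFin \o w) = 0%E.
  have := energy_eq0 p0 mEw w0 Ew; apply: filterS => z H zT.
  have := H zT => /= -[] /eqP; rewrite normr_eq0 subr_eq0 => /eqP uv.
  by rewrite /= u0E// v0E// uv.
have Ewfin : energy p q k T (EFin \o w) \is a fin_num.
  by rewrite ge0_fin_numE// (le_lt_trans EwB)// ltry.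
move: (EwB) (Ew0); rewrite -(fineK Ewfin); set e := fine _.
rewrite !lee_fin => eB; rewrite le_eqVlt => /predU1P[<-//|e0].
exfalso.
(* With this choice w/del has energy (B/e) e = B, the same bound as for V. *)
pose del := (e / B) `^ q^-1.
have del0 : 0 < del by rewrite powR_gt0// divr_gt0.
have delq : del `^ q = e / B.
  by rewrite -powRrM mulVf ?gt_eqF// powRr1// divr_ge0// ltW.
have delVq : del^-1 `^ q = B / e.
  by rewrite -powR_inv1 ?(ltW del0)// -powRrM mulN1r powRN delq invf_div.
pose G z := V z + del^-1 * w z.
have G0 z : 0 <= G z by rewrite addr_ge0// mulr_ge0// invr_ge0 ltW.
have mdw : measurable_fun setT (fun z => del^-1 * w z).
  by apply: measurable_funM => //; exact: measurable_cst.
have mG : measurable_fun setT G by exact: measurable_funD.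
have mEG : measurable_fun setT (EFin \o G) by exact/measurable_EFinP.
have EG : (energy p q k T (EFin \o G) <= (2 * K * B)%:E)%E.
  have -> : EFin \o G = (fun z => (EFin \o V) z + (del^-1)%:E * (EFin \o w) z)%E by [].
  have mEdw : measurable_fun setT (fun z => (del^-1)%:E * (EFin \o w) z)%E.
    exact/measurable_EFinP.
  have dw0 z : (0 <= (del^-1)%:E * (EFin \o w) z)%E.
    by rewrite -EFinM lee_fin mulr_ge0// invr_ge0 ltW.
  apply: (le_trans (energy_add_le k T p0 q0 mEV mEdw V0 dw0)).
  rewrite energy_scale ?invr_ge0 ?(ltW del0)// -(fineK Ewfin) -/e -EFinM.
  apply: (@le_trans _ _ (K%:E * (B%:E + B%:E))%E).
    apply: lee_wpmul2l; first by rewrite lee_fin ltW.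
    apply: leeD EVB _; rewrite lee_fin.
    by rewrite delVq divfK ?gt_eqF.
  by rewrite -EFinD -EFinM lee_fin; lra.
pose g (z : spacetime) := ((m * del)%:E * duhamel (fun z => (EFin \o G) z `^ alpha) z)%E.
have mGa : measurable_fun setT (fun z => (EFin \o G) z `^ alpha)%E.
  exact: measurableT_comp (@measurable_poweR _ _) mEG.
have Ga0 z : (0 <= (EFin \o G) z `^ alpha)%E by exact: poweR_ge0.
have md0 : 0 <= m * del by rewrite mulr_ge0// ltW.
have g0 z : (0 <= g z)%E by rewrite mule_ge0// ?lee_fin// duhamel_ge0.
have mDG : measurable_fun setT (duhamel (fun z => (EFin \o G) z `^ alpha)%E).
  exact: measurable_duhamel.
have mg : measurable_fun setT g.
  by apply: emeasurable_funM => //; exact: measurable_cst.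
have Eufin : (energy p q k T (fun z => (`|u z|)%:E) < +oo)%E.
  by rewrite (le_lt_trans Eu)// ltry.
have Evfin : (energy p q k T (fun z => (`|v z|)%:E) < +oo)%E.
  by rewrite (le_lt_trans Ev)// ltry.
have wg : {ae (lebn \x leb)%E, forall z, slab T z -> ((w z)%:E <= g z)%E}.
  have Fu := duhamel_pow_lty_ae T0 mu Eufin; have Fv := duhamel_pow_lty_ae T0 mv Evfin.
  apply: filterS2 (filterI Fu Fv) (filterI eu0 ev0) => z [finu finv] [Hu Hv] zT.
  have uz : (u z)%:E = mild_map alpha U u z.
    by rewrite -(eq_mild_map alpha U zT u0E) -u0E//; exact: Hu.
  have vz : (v z)%:E = mild_map alpha U v z.
    by rewrite -(eq_mild_map alpha U zT v0E) -v0E//; exact: Hv.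
  apply: (le_trans (mild_difference_le alpha1 mu mv (finu zT) (finv zT) uz vz)).
  rewrite /g -duhamelZ//; apply: duhamel_le => //.
  - apply/measurable_EFinP; apply: measurableT_comp (@normr_measurable _ _) _.
    apply: measurable_funB.
      exact: measurableT_comp (measurable_signed_pow _) mu.
    exact: measurableT_comp (measurable_signed_pow _) mv.
  - by apply: emeasurable_funM => //; exact: measurable_cst.
  - by move=> z'; rewrite mule_ge0// lee_fin.
  - move=> y s _; move: (y, s) => z'; rewrite poweR_EFin -EFinM lee_fin.
    apply: (le_trans (signed_pow_lip _ _ alpha1)); rewrite -/m -mulrA ler_wpM2l//.
    rewrite -/(V z') -/(w z') -(powRS_sub1 alpha1 (G0 z')).
    (* V^(alpha-1) w = del V^(alpha-1) (w/del), and both V and w/del are at most G. *)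
    have -> : w z' = del * (del^-1 * w z') by rewrite mulrA divff ?mul1r// gt_eqF.
    rewrite mulrCA ler_wpM2l ?(ltW del0)//.
    have dw0 : 0 <= del^-1 * w z' by rewrite mulr_ge0// invr_ge0 ltW.
    apply: ler_pM; rewrite ?powR_ge0//; last by rewrite lerDr.
    by apply: ge0_ler_powR; rewrite ?nnegrE// ?subr_ge0 ?(ltW alpha1)// lerDl.
have := energy_le_ae k p0 q0 mw mg w0 g0 wg.
rewrite leNgt => /negP; apply.
apply: (@le_lt_trans _ _ (K%:E * (((m * del) `^ q)%:E *
    ((C * T `^ r)%:E * (2 * K * B)%:E `^ alpha)))%E).
  apply: lee_wpmul2l; first by rewrite lee_fin ltW.
  rewrite energy_scale//; last by move=> z; exact: duhamel_ge0.
  apply: lee_wpmul2l; first by rewrite lee_fin powR_ge0.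
  apply: (le_trans (contraction T0 mEG G0)).
  apply: lee_wpmul2l; first by rewrite lee_fin mulr_ge0 ?powR_ge0.
  by apply: le_poweR EG; [exact: ltW|exact: energy_ge0].
rewrite poweR_EFin -!EFinM -(fineK Ewfin) -/e lte_fin powRM ?(ltW del0)// delq.
rewrite (_ : _ * _ = e * (X * T `^ r)); first by rewrite gtr_pMr.
by rewrite /X; field; rewrite gt_eqF.
Qed.

Lemma energy_time_le (f : spacetime -> \bar R) (T1 T2 : R) : T1 <= T2 ->
  measurable_fun setT f -> (energy p q k T1 f <= energy p q k T2 f)%E.
Proof.
move=> T12 mf; apply: ge0_subset_integral => //.
- by apply: measurable_funTS; exact: measurable_energy_integrand.
- by move=> t _; rewrite mule_ge0 ?poweR_ge0// lee_fin powR_ge0.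
- by apply: subset_itvl; rewrite bnd_simp.
Qed.

(* Monotone iteration [V |-> H + duhamel (V `^ alpha)] from [0]. *)
Lemma supersolution_exists (T0 : R) (H : spacetime -> \bar R) : 0 < T0 ->
  measurable_fun setT H -> (forall z, 0 <= H z)%E -> (energy p q k T0 H < +oo)%E ->
  exists T V, [/\ 0 < T <= T0, measurable_fun setT V, forall z, (0 <= V z)%E,
    (energy p q k T V < +oo)%E &
    forall z, (H z + duhamel (fun z => V z `^ alpha) z <= V z)%E].
Proof.
move=> T00 mH H0 EHfin.
have [b EHb] : exists b, energy p q k T0 H = b%:E.
  exists (fine (energy p q k T0 H)); rewrite fineK// ge0_fin_numE//.
  exact: energy_ge0.
have b0 : 0 <= b by rewrite -lee_fin -EHb energy_ge0.
pose B := 2 * K * b + 1.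
have B0 : 0 < B by rewrite ltr_wpDl// mulr_ge0// mulr_ge0// ltW.
(* X T^r < 1 means K C T^r B^alpha <= B/2, while K b <= B/2 by the choice of B; thus the bound B on
   the energy passes from each iterate to the next. *)
pose X := 2 * K * C * B `^ alpha / B.
have X0 : 0 <= X.
  by rewrite divr_ge0 ?(ltW B0)// !mulr_ge0 ?powR_ge0// ltW.
have [T [T_gt0 TT0 XT]] := small_time X0 T00.
pose F (W : spacetime -> \bar R) z := (H z + duhamel (fun z => W z `^ alpha) z)%E.
pose V_ j := iter j F (cst 0%E).
have mpow (W : spacetime -> \bar R) : measurable_fun setT W ->
    measurable_fun setT (fun z => W z `^ alpha)%E.
  by move=> mW; exact: measurableT_comp (@measurable_poweR _ _) mW.
have pow0 (W : spacetime -> \bar R) z : (0 <= W z `^ alpha)%E by exact: poweR_ge0.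
have mDV (W : spacetime -> \bar R) : measurable_fun setT W ->
    measurable_fun setT (duhamel (fun z => W z `^ alpha)%E).
  by move=> mW; apply: measurable_duhamel (mpow _ mW) (pow0 W).
have D0 (W : spacetime -> \bar R) z : (0 <= duhamel (fun z => W z `^ alpha)%E z)%E.
  exact: duhamel_ge0 (pow0 W) z.
have mV j : measurable_fun setT (V_ j).
  elim: j => [|j IH]; first exact: measurable_cst.
  exact: emeasurable_funD mH (mDV _ IH).
have V0 j z : (0 <= V_ j z)%E.
  by case: j => [|j]//=; rewrite /F adde_ge0.
have Fle (W W' : spacetime -> \bar R) z : measurable_fun setT W ->
    measurable_fun setT W' -> (forall z, 0 <= W z)%E -> (forall z, W z <= W' z)%E ->
    (F W z <= F W' z)%E.
  move=> mW mW' W0 WW'; rewrite /F; apply: leeD => //.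
  apply: (duhamel_le (mpow _ mW) (mpow _ mW') (pow0 W) (pow0 W')) => y s _.
  by apply: le_poweR => //; exact: ltW.
have VS j z : (V_ j z <= V_ j.+1 z)%E.
  elim: j z => [|j IH] z; first exact: V0.
  exact: Fle (mV j) (mV j.+1) (V0 j) IH.
have ndV z : nondecreasing_seq (V_ ^~ z) by apply/nondecreasing_seqP => j; exact: VS.
have EV j : (energy p q k T (V_ j) <= B%:E)%E.
  elim: j => [|j IH].
    rewrite (_ : energy p q k T (V_ 0%N) = 0%E) ?lee_fin ?(ltW B0)//.
    by apply: energy_ae0 => //; exact: aeW.
  apply: (le_trans (energy_add_le k T p0 q0 mH (mDV _ (mV j)) H0 (D0 (V_ j)))).
  apply: (@le_trans _ _ (K%:E * (b%:E + (C * T `^ r)%:E * B%:E `^ alpha))%E).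
    apply: lee_wpmul2l; first by rewrite lee_fin ltW.
    apply: leeD; first by rewrite -EHb; exact: energy_time_le.
    apply: (le_trans (contraction T_gt0 (mV j) (V0 j))).
    apply: lee_wpmul2l; first by rewrite lee_fin mulr_ge0 ?powR_ge0.
    by apply: le_poweR IH; [exact: ltW|exact: energy_ge0].
  rewrite poweR_EFin -EFinM lee_fin.
  have XE : X * T `^ r * B = 2 * (K * (C * T `^ r * B `^ alpha)).
    by rewrite /X; field; rewrite gt_eqF.
  have : X * T `^ r * B <= B by rewrite ler_piMl ?(ltW B0)// ltW.
  have BE : B = 2 * K * b + 1 by [].
  rewrite XE mulrDr; move: (K * (C * _ * _)) BE => Y; lra.
pose V z := limn (V_ ^~ z).
have VV j z : (V_ j z <= V z)%E.
  apply: lime_ge; first exact: ereal_nondecreasing_is_cvgn.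
  by exists j => // i /= ji; exact: ndV.
have V_ge0 z : (0 <= V z)%E by exact: le_trans (VV 0%N z).
have mVV : measurable_fun setT V.
  apply: (@emeasurable_fun_cvg _ _ _ _ V_) => // z _.
  exact: ereal_nondecreasing_is_cvgn.
exists T, V; split => //; first by rewrite T_gt0.
  by apply: le_lt_trans (ltry B); apply: energy_sup_le.
move=> z; pose P j z := (V_ j z `^ alpha)%E.
have ndP z' : nondecreasing_seq (P ^~ z').
  by move=> i j ij; apply: le_poweR; [exact: ltW| |exact: ndV].
have mP j : measurable_fun setT (P j) by exact: mpow.
have P0 j z' : (0 <= P j z')%E by exact: poweR_ge0.
have DV : (duhamel (fun z => V z `^ alpha)%E z <= limn (fun j => duhamel (P j) z))%E.
  rewrite -(duhamel_lim z mP P0 ndP).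
  apply: duhamel_le => //.
  - exact: mpow.
  - apply: (@emeasurable_fun_cvg _ _ _ _ P) => // z' _.
    exact: ereal_nondecreasing_is_cvgn.
  - by move=> z'; apply: lime_ge; [exact: ereal_nondecreasing_is_cvgn|exact: nearW].
  - move=> y s _; have := @poweR_limn_le _ (V_ ^~ (y, s)) alpha 1 alpha0 ltr01.
    rewrite mule1 (_ : (fun j => _ * 1%:E)%E = P ^~ (y, s)).
      by apply => //; exact: ndV.
    by apply/funext => j; rewrite mule1.
have DP j : (H z + duhamel (P j) z <= V z)%E by exact: (VV j.+1 z).
(* Where H is infinite so is V. Elsewhere H z can be moved to the other side before passing to the
   limit. *)
have [Hy|Hfin] := eqVneq (H z) +oo%E.
  have := DP 0%N; rewrite Hy addye; last by rewrite -ltNye (lt_le_trans (ltNyr 0%R))// duhamel_ge0.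
  by rewrite leye_eq => /eqP ->; rewrite leey.
have Hfn : H z \is a fin_num by rewrite ge0_fin_numE// ltey.
rewrite addeC -leeBrDr//; apply: (le_trans DV); apply: lime_le.
  apply: ereal_nondecreasing_is_cvgn => i j ij.
  by apply: duhamel_le => // y s _; exact: ndP.
by apply: nearW => j; rewrite leeBrDr// addeC.
Qed.

Lemma signed_pow_cvg (x_ : nat -> R) (x c : R) : (forall j, `|x_ j| <= c) -> `|x| <= c ->
  (x_ j @[j --> \oo] --> x)%classic ->
  (signed_pow alpha (x_ j) @[j --> \oo] --> signed_pow alpha x)%classic.
Proof.
move=> xc xc' cvx; pose M := (Num.bound alpha)%:R * (c + c) `^ (alpha - 1) + 1.
have M0 : 0 < M by rewrite ltr_wpDl// mulr_ge0// powR_ge0.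
apply/cvgrPdist_le => e e0.
have eM : 0 < e / M by rewrite divr_gt0.
move/cvgrPdist_le: cvx => /(_ _ eM); apply: filterS => j xj.
apply: (le_trans (signed_pow_lip _ _ alpha1)); rewrite mulrA.
apply: (@le_trans _ _ (M * (e / M))); last by rewrite mulrC divfK// gt_eqF.
apply: ler_pM => //.
apply: (@le_trans _ _ ((Num.bound alpha)%:R * (c + c) `^ (alpha - 1))).
  apply: ler_wpM2l => //; apply: ge0_ler_powR.
  - by rewrite subr_ge0 ltW.
  - by rewrite nnegrE addr_ge0.
  - by rewrite nnegrE addr_ge0// (le_trans _ xc').
  - exact: lerD.
by rewrite /M lerDl.
Qed.

(* Since the nonlinearity is nondecreasing, the fixed-point map is monotone, and
   iterating it from [- V] converges monotonically. *)
Lemma mild_fixed_point (V h : spacetime -> R) (S : set spacetime) :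
  measurable S -> measurable_fun setT V -> measurable_fun setT h ->
  (forall z, 0 <= V z) -> (forall z, ~ S z -> V z = 0) ->
  (forall z, S z ->
    ((`|h z|)%:E + duhamel (fun z : spacetime => (V z `^ alpha)%:E) z <= (V z)%:E)%E) ->
  exists u : spacetime -> R, [/\ measurable_fun setT u, forall z, `|u z| <= V z &
    forall z, S z -> (u z)%:E = ((h z)%:E +
      \int[leb]_(s in `]0%R, (z.2 : R)[) \int[lebn]_y
        (heat_kernel ((z.2 : R) - s) (subRn z.1 y) * signed_pow alpha (u (y, s)))%:E)%E].
Proof.
move=> mS mV mh V0 VS super.
pose Va (z : spacetime) := V z `^ alpha.
have Va0 z : 0 <= Va z by exact: powR_ge0.
have mVa : measurable_fun setT Va by exact: measurableT_comp (@measurable_powR _ _) mV.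
have mEVa : measurable_fun setT (EFin \o Va) by exact/measurable_EFinP.
have EVa0 z : (0 <= (EFin \o Va) z)%E by rewrite lee_fin.
pose D z := duhamel (EFin \o Va) z.
have D0 z : (0 <= D z)%E by exact: duhamel_ge0.
have Dfin z : S z -> exists d, [/\ D z = d%:E, 0 <= d & `|h z| + d <= V z].
  move=> zS; have := super z zS; rewrite -/(D z); have := D0 z.
  case: (D z) => [d| |]//= d0.
  by rewrite -EFinD lee_fin => ?; exists d.
(* Adding V^alpha makes the source nonnegative whenever |u| <= V, so order and monotone convergence
   apply; its Duhamel integral [D], finite on S, is subtracted afterwards. *)
pose src (u : spacetime -> R) z := signed_pow alpha (u z) + Va z.
have src_bnd (u : spacetime -> R) z : `|u z| <= V z -> 0 <= src u z <= 2 * Va z.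
  move=> uV; have : `|signed_pow alpha (u z)| <= Va z.
    by rewrite normr_signed_pow// ge0_ler_powR ?nnegrE// ltW.
  by rewrite /src ler_norml => /andP[]; move: (signed_pow _ _) => *; apply/andP; split; lra.
have msrc (u : spacetime -> R) : measurable_fun setT u -> measurable_fun setT (src u).
  move=> mu; apply: measurable_funD => //.
  exact: measurableT_comp (measurable_signed_pow _) mu.
pose DS u z := duhamel (EFin \o src u) z.
have mEsrc (u : spacetime -> R) : measurable_fun setT u -> measurable_fun setT (EFin \o src u).
  by move=> mu; apply/measurable_EFinP; exact: msrc.
have Esrc0 (u : spacetime -> R) : (forall z, `|u z| <= V z) -> forall z, (0 <= (EFin \o src u) z)%E.
  by move=> uV z; rewrite lee_fin; have /andP[] := src_bnd u z (uV z).
have DS0 (u : spacetime -> R) z : (forall z, `|u z| <= V z) -> (0 <= DS u z)%E.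
  by move=> uV; exact: duhamel_ge0 (Esrc0 _ uV) z.
have mDS (u : spacetime -> R) : measurable_fun setT u -> (forall z, `|u z| <= V z) ->
    measurable_fun setT (DS u).
  by move=> mu uV; exact: measurable_duhamel (mEsrc _ mu) (Esrc0 _ uV).
have DS2 (u : spacetime -> R) z : measurable_fun setT u -> (forall z, `|u z| <= V z) ->
    (DS u z <= 2%:E * D z)%E.
  move=> mu uV; rewrite /DS /D -(duhamelZ z (ler0n R 2) mEVa EVa0).
  apply: (duhamel_le (mEsrc _ mu) _ (Esrc0 _ uV)) => [|z'|y s _].
  - by apply: emeasurable_funM => //; exact: measurable_cst.
  - by rewrite mule_ge0// lee_fin.
  - by rewrite -EFinM lee_fin; have /andP[] := src_bnd u (y, s) (uV _).
have DSle (u v : spacetime -> R) z : measurable_fun setT u -> measurable_fun setT v ->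
    (forall z, `|u z| <= V z) -> (forall z, `|v z| <= V z) -> (forall z, u z <= v z) ->
    (DS u z <= DS v z)%E.
  move=> mu mv uV vV uv.
  apply: (duhamel_le (mEsrc _ mu) (mEsrc _ mv) (Esrc0 _ uV) (Esrc0 _ vV)) => y s _.
  by rewrite lee_fin lerD2r signed_pow_le.
have DSfin (u : spacetime -> R) z : measurable_fun setT u -> (forall z, `|u z| <= V z) -> S z ->
    exists d e, [/\ D z = d%:E, `|h z| + d <= V z, DS u z = e%:E, 0 <= e & e <= 2 * d].
  move=> mu uV /Dfin[d [dE d0 dV]].
  have := DS2 u z mu uV; have := DS0 u z uV; rewrite dE -EFinM.
  by case: (DS u z) => [e| |]//=; rewrite !lee_fin => e0 e2; exists d, e.
pose step (u : spacetime -> R) z := \1_S z * (h z + fine (DS u z) - fine (D z)).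
have stepS u z : S z -> step u z = h z + fine (DS u z) - fine (D z).
  by move=> zS; rewrite /step indicE mem_set// mul1r.
have stepN u z : ~ S z -> step u z = 0.
  by move=> zS; rewrite /step indicE memNset// mul0r.
have mstep (u : spacetime -> R) : measurable_fun setT u -> (forall z, `|u z| <= V z) ->
    measurable_fun setT (step u).
  move=> mu uV; apply: measurable_funM; first exact: measurable_indic.
  apply: measurable_funB; first apply: measurable_funD => //.
  - exact: measurableT_comp (fine_measurable measurableT) (mDS _ mu uV).
  - apply: measurableT_comp (fine_measurable measurableT) _.
    exact: measurable_duhamel.
have step_bnd (u : spacetime -> R) : measurable_fun setT u -> (forall z, `|u z| <= V z) ->
    forall z, `|step u z| <= V z.
  move=> mu uV z; have [zS|zS] := pselect (S z); last by rewrite stepN// normr0 V0.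
  rewrite stepS//; have [d [e [-> dV -> e0 ed]]] := DSfin u z mu uV zS.
  apply: le_trans dV; rewrite /= ler_norml; have := ler_norm (h z).
  have := ler_norm (- h z); rewrite normrN => *; apply/andP; split; lra.
have step_le (u v : spacetime -> R) : measurable_fun setT u -> measurable_fun setT v ->
    (forall z, `|u z| <= V z) -> (forall z, `|v z| <= V z) -> (forall z, u z <= v z) ->
    forall z, step u z <= step v z.
  move=> mu mv uV vV uv z; have [zS|zS] := pselect (S z); last by rewrite !stepN.
  rewrite !stepS// lerD2r lerD2l.
  have := DSle u v z mu mv uV vV uv.
  have [d [e [_ _ -> _ _]]] := DSfin u z mu uV zS.
  by have [d' [e' [_ _ -> _ _]]] := DSfin v z mv vV zS; rewrite lee_fin.
(* [step] preserves |u| <= V, so the first iterate lies above -V; as [step] preserves order, the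
   sequence increases. *)
pose u_ j := iter j step (fun z => - V z).
have uP j : measurable_fun setT (u_ j) /\ (forall z, `|u_ j z| <= V z).
  elim: j => [|j [mu uV]]; split => /=.
  - exact: measurable_funN.
  - by move=> z; rewrite normrN ger0_norm.
  - exact: mstep.
  - exact: step_bnd.
have mu_ j := (uP j).1; have uV_ j := (uP j).2.
have uS j z : u_ j z <= u_ j.+1 z.
  elim: j z => [|j IH] z.
    by have := step_bnd _ (mu_ 0%N) (uV_ 0%N) z; rewrite ler_norml => /andP[].
  exact: step_le (mu_ j) (mu_ j.+1) (uV_ j) (uV_ j.+1) IH z.
have ndu z : nondecreasing_seq (u_ ^~ z) by apply/nondecreasing_seqP => j; exact: uS.
have ubu z j : u_ j z <= V z by exact: le_trans (ler_norm _) (uV_ j z).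
have cvu z : cvgn (u_ ^~ z).
  apply: nondecreasing_is_cvgn => //; exists (V z) => _ [j _ <-]; exact: ubu.
pose u z := limn (u_ ^~ z).
have u_le j z : u_ j z <= u z by exact: nondecreasing_cvgn_le.
have mu : measurable_fun setT u.
  by apply: (@measurable_fun_cvg _ _ _ _ u_) => // z _; exact: cvu.
have uV z : `|u z| <= V z.
  rewrite ler_norml; apply/andP; split.
    exact: (u_le 0%N z).
  by apply: limr_le; [exact: cvu|apply: nearW => j; exact: ubu].
exists u; split => // z zS.
have DSlim : DS u z = limn (fun j => DS (u_ j) z).
  rewrite -duhamel_lim; last 3 first.
  - by move=> j; exact: mEsrc.
  - by move=> j; exact: Esrc0.
  - by move=> z' i j ij; rewrite lee_fin lerD2r signed_pow_le// ndu.
  congr (duhamel _ z); apply/funext => z'; apply/esym/cvg_lim => //.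
  apply: cvg_EFin; first exact: nearW.
  apply: cvgD; last exact: cvg_cst.
  by apply: (@signed_pow_cvg _ _ (V z')) => //; exact: cvu.
have [d [e [dE dV eE e0 ed]]] := DSfin u z mu uV zS.
(* The upper bound on u uses u_j <= u and order; the lower bound uses that [DS u] is the limit of
   the [DS (u_ j)]. *)
have uE : u z = h z + e - d.
  apply/eqP; rewrite eq_le; apply/andP; split.
    apply: limr_le; first exact: cvu.
    apply: nearW => j; apply: (le_trans (uS j z)).
    have := DSle (u_ j) u z (mu_ j) mu (uV_ j) uV (u_le j).
    rewrite /= stepS// dE eE; have [d' [e' [_ _ -> _ _]]] := DSfin (u_ j) z (mu_ j) (uV_ j) zS.
    by rewrite lee_fin /=; lra.
  suff : (DS u z <= (u z - h z + d)%:E)%E by rewrite eE lee_fin; lra.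
  rewrite DSlim; apply: lime_le.
    apply: ereal_nondecreasing_is_cvgn => i j ij; apply: DSle => // z'.
    exact: ndu.
  apply: nearW => j; have := u_le j.+1 z; rewrite /= stepS// dE.
  have [d' [e' [_ _ -> _ _]]] := DSfin (u_ j) z (mu_ j) (uV_ j) zS.
  by rewrite lee_fin /=; lra.
rewrite (@duhamel_sub _ _ (fun z => signed_pow alpha (u z)) (src u) Va)//.
- by rewrite -/(DS u z) -/(D z) dE eE -EFinB -EFinD uE addrA.
- exact: msrc.
- by move=> z'; have /andP[] := src_bnd u z' (uV z').
- by move=> z'; rewrite /src addrK.
- by rewrite -/(DS u z) eE ltry.
- by rewrite -/(D z) dE ltry.
Qed.

(** The supersolution built from |h| dominates the heat flow, so both are real off a null set of the
    slab. The equation is solved at every point of the remaining set S, which is enough for almost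
    everywhere equality, and |u| <= V bounds the energy. *)
Lemma mild_solution_exists (T0 : R) : 0 < T0 -> mixed_space p q k T0 (heat_flow U) ->
  exists2 T : R, 0 < T & exists u : spacetime -> R, mild_solution alpha p q k T U u.
Proof.
move=> T00 [mhf nhf]; pose hT := heat_flow U \_ (slab T0).
have mhT : measurable_fun setT hT.
  exact: (proj1 (measurable_restrictT _ (measurable_slab _))).
pose H z := `|hT z|%E.
have mH : measurable_fun setT H by exact: measurableT_comp (@abse_measurable _ _) mhT.
have H0 z : (0 <= H z)%E by exact: abse_ge0.
have EH : (energy p q k T0 H < +oo)%E.
  have -> : energy p q k T0 H = energy p q k T0 (fun z => `|heat_flow U z|)%E.
    by apply: eq_energy => z zT; rewrite /H /hT /patch mem_set.
  move: nhf; rewrite mixed_normE => /lty_poweRy; apply.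
  by rewrite invr_eq0 gt_eqF.
have [T [V [/andP[T_gt0 TT0] mV V0 EV super]]] := supersolution_exists T00 mH H0 EH.
exists T => //.
(* Setting V to 0 outside S only decreases its Duhamel integral, so the supersolution inequality
   survives on S, now for a real-valued function. *)
pose S := slab T `&` [set z | (V z < +oo)%E].
have mS : measurable S.
  by apply: emeasurable_fun_infty_o; [exact: measurable_slab|exact: measurable_funTS].
pose Vr (z : spacetime) := \1_S z * fine (V z).
pose hr (z : spacetime) := fine (hT z).
have mfine (f : spacetime -> \bar R) : measurable_fun setT f -> measurable_fun setT (fine \o f).
  by move=> mf; exact: measurableT_comp (fine_measurable measurableT) mf.
have mVr : measurable_fun setT Vr.
  by apply: measurable_funM; [exact: measurable_indic|exact: mfine].
have VrE z : S z -> (Vr z)%:E = V z.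
  by move=> zS; rewrite /Vr indicE mem_set// mul1r fineK// ge0_fin_numE//; case: zS.
have VrN z : ~ S z -> Vr z = 0 by move=> zS; rewrite /Vr indicE memNset// mul0r.
have VrV z : ((Vr z)%:E <= V z)%E.
  by have [zS|zS] := pselect (S z); [rewrite VrE|rewrite VrN].
have Vr0 z : 0 <= Vr z.
  by have [zS|zS] := pselect (S z); [rewrite -lee_fin VrE|rewrite VrN].
have mVra : measurable_fun setT (fun z : spacetime => (Vr z `^ alpha)%:E).
  by apply/measurable_EFinP; exact: measurableT_comp (@measurable_powR _ _) mVr.
have mVa : measurable_fun setT (fun z => V z `^ alpha)%E.
  exact: measurableT_comp (@measurable_poweR _ _) mV.
have superS z : S z -> (H z + duhamel (fun z : spacetime => (Vr z `^ alpha)%:E) z <= (Vr z)%:E)%E.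
  move=> zS; rewrite VrE//; apply: le_trans (super z); apply: leeD => //.
  apply: duhamel_le => // [z'|z'|y s _].
  - by rewrite lee_fin powR_ge0.
  - exact: poweR_ge0.
  - by rewrite -poweR_EFin; apply: le_poweR (VrV _); [exact: ltW|rewrite lee_fin].
have hfin z : S z -> (hr z)%:E = hT z.
  move=> zS; rewrite fineK// fin_num_abs; apply: le_lt_trans (ltry (Vr z)).
  apply: le_trans (superS z zS); rewrite leeDl// duhamel_ge0// => z'.
  by rewrite lee_fin powR_ge0.
have super' z : S z ->
    ((`|hr z|)%:E + duhamel (fun z : spacetime => (Vr z `^ alpha)%:E) z <= (Vr z)%:E)%E.
  by move=> zS; have := superS z zS; rewrite /H -hfin.
have [u [mu uV uE]] := mild_fixed_point mS mVr (mfine _ mhT) Vr0 VrN super'.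
exists u; split.
  split; first by apply: measurable_funTS; exact/measurable_EFinP.
  rewrite mixed_normE; apply: poweR_lty; apply: le_lt_trans EV.
  apply: energy_le => //.
  - by apply/measurable_EFinP; exact: measurableT_comp (@normr_measurable _ _) mu.
  - by move=> z _; apply: le_trans (VrV z); rewrite lee_fin.
have Vae := energy_lty_ae p0 q0 mV V0 EV.
apply: filterS Vae => z Vfin zT.
have zS : S z by split => //; exact: Vfin.
rewrite [LHS]uE// -[(fine \o hT) z]/(hr z) hfin//; congr (_ + _)%E.
rewrite /hT /patch mem_set//; move: zT; rewrite /slab/= => /andP[-> zT].
exact: lt_le_trans TT0.
Qed.

End fixed_point.

Theorem theorem5p5 (R : realType) (n : nat) (alpha k p q : R)
    (U : Rn R n -> R) (T0 : R) :
  (0 < n)%N ->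
  1 < alpha -> 0 < k -> 1 < p -> 1 < q ->
  0 < T0 -> mixed_space p q k T0 (heat_flow U) ->
  let beta := n%:R / 2 * ((alpha - 1) / p) * (q / (q - alpha)) in
  k * alpha / (q - alpha) < 1 ->
  beta < 1 ->
  alpha < Num.min p q ->
  -1 < k + (q - alpha) * (1 - beta - k * alpha / (q - alpha)) ->
  (exists2 T : R, 0 < T & exists u : Rn R n * measurableTypeR R -> R,
     mild_solution alpha p q k T U u) /\
  (forall A : R, 0 < A -> exists2 T : R, 0 < T &
     forall u v : Rn R n * measurableTypeR R -> R,
     mild_solution alpha p q k T U u ->
     (mixed_norm p q k T (EFin \o u) <= A%:E)%E ->
     mild_solution alpha p q k T U v ->
     (mixed_norm p q k T (EFin \o v) <= A%:E)%E ->
     ae_eq_on T (EFin \o u) (EFin \o v)).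
Proof.
move=> n0 alpha1 k0 p1 q1 T00 hU beta gamma1 beta1 alphapq growth.
have [alphap alphaq] : alpha < p /\ alpha < q by move: alphapq; rewrite lt_min => /andP.
have p0 : 0 < p by exact: lt_trans p1.
have q0 : 0 < q by exact: lt_trans q1.
have r0 : 0 < k + (q - alpha) * (1 - beta - k * alpha / (q - alpha)) + 1.
  by rewrite -ltrBlDr sub0r.
have [C C0 contraction] :=
  @energy_duhamel_le R n alpha k p q alpha1 k0 alphap alphaq beta1 gamma1 growth.
split; first exact: (mild_solution_exists alpha1 p0 q0 C0 r0 contraction T00 hU).
exact: (mild_solution_unique U alpha1 p0 q0 C0 r0 contraction).
Qed.
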